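(* In the standing local setup, let $S=\frac{\partial\eta^{\bar\beta}}{\partial w_\alpha}\frac{\partial\eta^\alpha}{\partial\bar w_\beta}$ $\big(=g^{\alpha\bar p}\phi_{,z\bar i\bar p}\,g^{\bar iq}\phi_{,\bar z\alpha q}\ge0$, covariant derivatives with respect to $g$; this is minus the trace of the curvature of the bundles $f^*T^{1,0}M$ along leaves$\big)$. Then along every leaf $$\partial_z\overline{\partial_z}\,S\ \ge\ \frac2n\,S^2 .$$
   Context: Standing local setup: $(M,\omega_0)$ is a Kähler manifold of complex dimension $n$, $\Sigma\subset\mathbb C$ a domain with coordinate $z$, and $\phi$ a smooth real function on $\Sigma\times M$ such that $\omega_\phi=\omega_0+\sqrt{-1}\partial\bar\partial_M\phi(z,\cdot)>0$ on $M$ for each $z$ and $(\pi_2^*\omega_0+\sqrt{-1}\partial\bar\partial\phi)^{n+1}=0$ on $\Sigma\times M$. In local holomorphic coordinates $w=(w_1,\dots,w_n)$ on $M$ write $g_{\alpha\bar\beta}=g_{0,\alpha\bar\beta}+\partial^2\phi/\partial w_\alpha\partial\bar w_\beta$ (the metric of $\omega_\phi$), $(g^{\alpha\bar\beta})$ its inverse, $\eta^\alpha=-g^{\alpha\bar\beta}\,\partial^2\phi/\partial z\partial\bar w_\beta$, $\eta^{\bar\alpha}=\overline{\eta^\alpha}$, $X=\eta^\alpha\partial/\partial w_\alpha$ (leaf vector field; $\partial/\partial z+X$ spans the kernel of $\pi_2^*\omega_0+\sqrt{-1}\partial\bar\partial\phi$), $\partial_z=\partial/\partial z+\eta^\alpha\partial/\partial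 w_\alpha$ and $\overline{\partial_z}=\partial/\partial\bar z+\eta^{\bar\alpha}\partial/\partial\bar w_\alpha$; summation over repeated indices. Integral curves of $\partial_z$ are holomorphic curves $z\mapsto(z,f(z))$ with $f'=\eta$ (the leaves). *)

(* Defs.v *)
From HB Require Import structures.
From mathcomp Require Import all_boot all_order all_algebra.
From mathcomp Require Import all_classical all_reals all_analysis.
From mathcomp Require Import complex.
Import Order.TTheory GRing.Theory Num.Theory.
Import numFieldNormedType.Exports.

Set Implicit Arguments.
Unset Strict Implicit.
Unset Printing Implicit Defensive.

Local Open Scope ring_scope.
Local Open Scope classical_set_scope.
Local Open Scope complex_scope.

(* Smoothness (C^infinity) of a real function on an open set of a      *)
(* finite-dimensional real normed space: all iterated directional       *)
(* derivatives exist and are (Frechet) differentiable on D.            *)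
Fixpoint iterD (R : realType) (V : normedModType R) (vs : seq V)
    (f : V -> R) : V -> R :=
  match vs with
  | [::] => f
  | v :: vs' => fun x => 'D_v (iterD vs' f) x
  end.

Definition smooth_on (R : realType) (V : normedModType R) (D : set V)
    (f : V -> R) : Prop :=
  forall (vs : seq V) (x : V), D x -> differentiable (iterD vs f) x.

(* real directional derivative of a complex-valued function *)
Definition pdC (R : realType) (V : normedModType R) (v : V)
    (F : V -> R[i]) (x : V) : R[i] :=
  (('D_v (fun y => complex.Re (F y)) x)%:C + 'i%C * ('D_v (fun y => complex.Im (F y)) x)%:C)%C.

(* coordinate direction vectors *)
Definition unitrow (R : realType) (m : nat) (j : 'I_m) : 'rV[R]_m :=
  \row_(k < m) (k == j)%:R.

(* Local coordinates.                                                   *)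
(*  Pt R n : real coordinates of a point (z, w_1..w_n) of Sigma x M,    *)
(*   p = (x, y) with complex coordinate j equal to x_j + i y_j;        *)
(*   j = ord0 is z, j = lift ord0 a is w_(a+1).                         *)
(*  Mpt R n : real coordinates of a point (w_1..w_n) of M (a chart).    *)
Definition Pt (R : realType) (n : nat) := ('rV[R]_n.+1 * 'rV[R]_n.+1)%type.
Definition Mpt (R : realType) (n : nat) := ('rV[R]_n * 'rV[R]_n)%type.

Definition zpart (R : realType) (n : nat) (p : Pt R n) : R * R :=
  (p.1 0 ord0, p.2 0 ord0).
Definition wpart (R : realType) (n : nat) (p : Pt R n) : Mpt R n :=
  (\row_(a < n) p.1 0 (lift ord0 a), \row_(a < n) p.2 0 (lift ord0 a)).

(* Wirtinger derivatives d/dzeta_j and d/dbar zeta_j on Sigma x M *)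
Definition dW (R : realType) (n : nat) (j : 'I_n.+1) (F : Pt R n -> R[i])
    (p : Pt R n) : R[i] :=
  (pdC (unitrow R j, 0) F p - 'i%C * pdC (0, unitrow R j) F p) / 2%:R.
Definition dWb (R : realType) (n : nat) (j : 'I_n.+1) (F : Pt R n -> R[i])
    (p : Pt R n) : R[i] :=
  (pdC (unitrow R j, 0) F p + 'i%C * pdC (0, unitrow R j) F p) / 2%:R.

(* Wirtinger derivatives d/dw_a, d/dbar w_a on the chart of M *)
Definition dWM (R : realType) (n : nat) (a : 'I_n) (F : Mpt R n -> R[i])
    (m : Mpt R n) : R[i] :=
  (pdC (unitrow R a, 0) F m - 'i%C * pdC (0, unitrow R a) F m) / 2%:R.

(* Hermitian positive definite matrix *)
Definition herm_posdef (R : realType) (n : nat) (A : 'M[R[i]]_n) : Prop :=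
  (forall a b, A b a = ((A a b)^*)%C) /\
  (forall v : 'rV[R[i]]_n, v != 0 ->
     0 < \sum_(a < n) \sum_(b < n) v 0 a * A a b * ((v 0 b)^*)%C).

(* The complex Hessian-type matrix of pi_2^* omega_0 + i ddbar phi on
   Sigma x M, in coordinates (z, w_1, ..., w_n):
   H j k = (pi_2^* g_0)_{j kbar} + d^2 phi / d zeta_j d bar zeta_k. *)
Definition g0ext (R : realType) (n : nat) (g0 : 'I_n -> 'I_n -> Mpt R n -> R[i])
    (j k : 'I_n.+1) (p : Pt R n) : R[i] :=
  match unlift ord0 j, unlift ord0 k with
  | Some a, Some b => g0 a b (wpart p)
  | _, _ => 0
  end.

Definition Hmat (R : realType) (n : nat) (g0 : 'I_n -> 'I_n -> Mpt R n -> R[i])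
    (phi : Pt R n -> R) (p : Pt R n) : 'M[R[i]]_n.+1 :=
  \matrix_(j, k) (g0ext g0 j k p + dW j (dWb k (fun q => (phi q)%:C)) p).

(* metric g_{a bbar} of omega_phi *)
Definition gmat (R : realType) (n : nat) (g0 : 'I_n -> 'I_n -> Mpt R n -> R[i])
    (phi : Pt R n -> R) (p : Pt R n) : 'M[R[i]]_n :=
  \matrix_(a, b) Hmat g0 phi p (lift ord0 a) (lift ord0 b).

(* eta^a = - g^{a bbar} phi_{z bbar}, where g^{a bbar} g_{c bbar} = delta^a_c,
   i.e. g^{a bbar} = (invmx gmat) b a. *)
Definition eta (R : realType) (n : nat) (g0 : 'I_n -> 'I_n -> Mpt R n -> R[i])
    (phi : Pt R n -> R) (a : 'I_n) (p : Pt R n) : R[i] :=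
  - \sum_(b < n) invmx (gmat g0 phi p) b a *
      dW ord0 (dWb (lift ord0 b) (fun q => (phi q)%:C)) p.

Definition etab (R : realType) (n : nat) (g0 : 'I_n -> 'I_n -> Mpt R n -> R[i])
    (phi : Pt R n -> R) (a : 'I_n) (p : Pt R n) : R[i] :=
  ((eta g0 phi a p)^*)%C.

(* the vector fields partial_z = d/dz + eta^a d/dw_a and its conjugate *)
Definition Dz (R : realType) (n : nat) (g0 : 'I_n -> 'I_n -> Mpt R n -> R[i])
    (phi : Pt R n -> R) (F : Pt R n -> R[i]) (p : Pt R n) : R[i] :=
  dW ord0 F p + \sum_(a < n) eta g0 phi a p * dW (lift ord0 a) F p.
Definition Dzb (R : realType) (n : nat) (g0 : 'I_n -> 'I_n -> Mpt R n -> R[i])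
    (phi : Pt R n -> R) (F : Pt R n -> R[i]) (p : Pt R n) : R[i] :=
  dWb ord0 F p + \sum_(a < n) etab g0 phi a p * dWb (lift ord0 a) F p.

(* S = (d eta^{bbar b} / d w_a) (d eta^a / d bar w_b) *)
Definition Sfun (R : realType) (n : nat) (g0 : 'I_n -> 'I_n -> Mpt R n -> R[i])
    (phi : Pt R n -> R) (p : Pt R n) : R[i] :=
  \sum_(a < n) \sum_(b < n)
     dW (lift ord0 a) (etab g0 phi b) p * dWb (lift ord0 b) (eta g0 phi a) p.

(* Main.v *)
(* The field V = d/dz + eta^a d/dw_a spans the kernel of the closed hermitian
   form H.  Differentiating V H = 0 along Vbar gives Vbar eta = 0, whence
   [V, Vbar] = 0.  With A = (dbar_b eta^a) and P = (d_b eta^a) this yields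
   Vbar A = - A Pbar and V Pbar = - Abar A, and so, for S = tr (Abar A),
     V Vbar S = 2 tr ((Abar A)^2) + tr (Qbar Q),   Q = V A - P A.
   Closedness of H makes A^T g, and hence Q^T g = V (A^T g), symmetric: the
   last trace is nonnegative, Abar A is self-adjoint for g, and Cauchy-Schwarz
   bounds the first term below by 2 S^2 / n. *)
Require Import Defs.
From HB Require Import structures.
From mathcomp Require Import all_boot all_order all_algebra.
From mathcomp Require Import all_classical all_reals all_analysis.
From mathcomp Require Import perm spectral sesquilinear complex ring.
Import Order.TTheory GRing.Theory Num.Theory.
Import numFieldNormedType.Exports.
Local Open Scope ring_scope.
Local Open Scope classical_set_scope.
Set Implicit Arguments.
Unset Strict Implicit.
Unset Printing Implicit Defensive.

(** The coordinate z is treated as coordinate 0 and V as the vector (1, eta), so that closedness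
    exchanges z and w indices alike: the first-order identities combine such an exchange with the
    Leibniz rule for V H = 0, or differentiate Vbar eta = 0. The obstacle in V Vbar S is V Vbar
    Abar, which holds third derivatives of eta and has no sign. It disappears because the fields
    commute and V Abar = - Abar P carries no derivative of A; what remains completes the square Qbar
    Q. The correction P A in Q is the price of V g = - P^T g when A^T g is differentiated. The
    factor 2 appears because V Pbar and its conjugate Vbar P each contribute one copy of tr ((Abar
    A)^2). In R[i] the relation x <= y also says that y - x is real, so a bound on real parts would
    not do: the traces are written as squared norms. Smoothness is given by iterated directional
    derivatives, so the commutation of Wirtinger derivatives rests on Schwarz's theorem, obtained
    from the mean value theorem. *)

(** * Smooth real functions and the symmetry of second derivatives *)

Section RealSmooth.
Variables (R : realType) (V : normedModType R).
Implicit Types (D : set V) (f g : V -> R) (u v w x : V).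

Lemma is_derive_line f x v (s : R) : derivable f (s *: v + x) v ->
  is_derive s 1 (fun t : R => f (t *: v + x)) ('D_v f (s *: v + x)).
Proof.
rewrite /derivable => df.
have E : (fun h : R => h^-1 *: (((fun t : R => f (t *: v + x)) \o shift s) (h *: 1) - f (s *: v + x)))
  = (fun h : R => h^-1 *: ((f \o shift (s *: v + x)) (h *: v) - f (s *: v + x))).
  apply/funext => h /=; congr (_ *: (f _ - _)).
  by rewrite scalerDl addrA; congr (_ *: _ + _ + _); rewrite /GRing.scale /= mulr1.
by split; rewrite /derivable /derive /= E.
Qed.

Lemma near0_line D x v w : open D -> D x ->
  exists2 d : R, 0 < d & forall s t : R, `|s| <= d -> `|t| <= d ->
    D (s *: v + (t *: w + x)).
Proof.
move=> oD Dx; have /nbhs_ballP[e /= e0 eD] : nbhs x D by exact: open_nbhs_nbhs.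
(* The summand 1 keeps [N] positive even when [v] and [w] both vanish. *)
set N := `|v| + `|w| + 1.
have N0 : 0 < N by rewrite ltr_wpDl // addr_ge0.
exists (e / (2 * N)); first by rewrite divr_gt0 // mulr_gt0.
move=> s t hs ht; apply: eD; rewrite -ball_normE /=.
rewrite addrA opprD addrCA subrr addr0 normrN.
apply: le_lt_trans (ler_normD _ _) _; rewrite !normrZ.
have : `|s| * `|v| + `|t| * `|w| <= e / (2 * N) * (`|v| + `|w|).
  by rewrite mulrDr lerD // ler_wpM2r.
move/le_lt_trans; apply.
have -> : e / (2 * N) * (`|v| + `|w|) = e / 2 * ((`|v| + `|w|) / N).
  by rewrite invfM !mulrA [_ * _ / N * _]mulrAC.
have h : (`|v| + `|w|) / N <= 1 by rewrite ler_pdivrMr // mul1r lerDl.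
apply: (@le_lt_trans _ _ (e / 2)).
  by rewrite -[leRHS]mulr1 ler_wpM2l // divr_ge0 // ltW.
by rewrite ltr_pdivrMr // mulr_natr mulr2n ltrDl.
Qed.

(* Two applications of the mean value theorem to the second difference. *)
Lemma second_difference D f x v w : open D -> D x ->
  (forall y, D y -> differentiable f y) ->
  (forall y, D y -> differentiable (fun z => 'D_v f z) y) ->
  exists2 d : R, 0 < d & forall h : R, 0 < h -> h <= d ->
    exists2 st : R * R, (`|st.1| <= h /\ `|st.2| <= h) &
      f (h *: v + (h *: w + x)) - f (h *: v + x) - f (h *: w + x) + f x =
      h ^+ 2 * 'D_w (fun z => 'D_v f z) (st.1 *: v + (st.2 *: w + x)).
Proof.
move=> oD Dx df ddf.
have [d d0 dD] := near0_line v w oD Dx.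
exists d => // h h0 hd.
have bnd (s : R) : s \in `[0, h]%R -> `|s| <= h.
  by rewrite in_itv /= => /andP[s0 sh]; rewrite ger0_norm.
have bnd' (s : R) : s \in `]0, h[%R -> `|s| <= h.
  by rewrite in_itv /= => /andP[s0 sh]; rewrite ger0_norm // ltW.
have nh : `|h| <= d by rewrite gtr0_norm.
have n0 : `|0 : R| <= d by rewrite normr0 ltW.
pose G (s : R) := f (s *: v + (h *: w + x)) - f (s *: v + x).
pose dG (s : R) := 'D_v f (s *: v + (h *: w + x)) - 'D_v f (s *: v + x).
have GD (s : R) : `|s| <= d -> is_derive s 1 G (dG s).
  move=> hs; apply: is_deriveB; apply: is_derive_line; apply: diff_derivable; apply: df.
    exact: dD.
  by have := dD s 0 hs n0; rewrite scale0r add0r.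
have [||s /[dup] sI /bnd' sh Gs] := @MVT R G dG 0 h h0.
- by move=> s /bnd' /le_trans/(_ hd); exact: GD.
- apply: derivable_within_continuous => s /bnd /le_trans/(_ hd) /GD.
  by move=> H; exact: ex_derive.
pose K (t : R) := 'D_v f (t *: w + (s *: v + x)).
pose dK (t : R) := 'D_w (fun z => 'D_v f z) (t *: w + (s *: v + x)).
have KD (t : R) : `|t| <= d -> is_derive t 1 K (dK t).
  move=> ht; apply: (is_derive_line (f := fun z => 'D_v f z)).
  apply: diff_derivable; apply: ddf; rewrite addrCA; apply: dD => //.
  exact: le_trans sh hd.
have [||t /bnd' th Kt] := @MVT R K dK 0 h h0.
- by move=> t /bnd' /le_trans/(_ hd); exact: KD.
- apply: derivable_within_continuous => t /bnd /le_trans/(_ hd) /KD.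
  by move=> H; exact: ex_derive.
exists (s, t) => //=.
have -> : f (h *: v + (h *: w + x)) - f (h *: v + x) - f (h *: w + x) + f x = G h - G 0.
  by rewrite /G !scale0r !add0r; ring.
rewrite Gs /dG.
have -> : 'D_v f (s *: v + (h *: w + x)) - 'D_v f (s *: v + x) = K h - K 0.
  by rewrite /K scale0r add0r addrCA.
by rewrite Kt /dK [t *: w + _]addrCA; ring.
Qed.

Lemma near_line (P : set V) x v w : nbhs x P ->
  exists2 d : R, 0 < d & forall s t : R, `|s| <= d -> `|t| <= d ->
    P (s *: v + (t *: w + x)).
Proof.
rewrite nbhsE => -[B [oB Bx] BP].
by have [d d0 H] := near0_line v w oB Bx; exists d => // s t hs ht; exact/BP/H.
Qed.

(** The second difference is symmetric in [v] and [w], so applying the mean value theorem in both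
    orders equates the two mixed derivatives at two points within the same small distance of [x];
    continuity brings both points back to [x]. *)
Lemma derive_comm D f x v w : open D -> D x ->
  (forall y, D y -> differentiable f y) ->
  (forall u y, D y -> differentiable (fun z => 'D_u f z) y) ->
  {for x, continuous (fun z => 'D_w (fun z => 'D_v f z) z)} ->
  {for x, continuous (fun z => 'D_v (fun z => 'D_w f z) z)} ->
  'D_w (fun z => 'D_v f z) x = 'D_v (fun z => 'D_w f z) x.
Proof.
move=> oD Dx df ddf c1 c2.
apply/eqP; rewrite -subr_eq0 -normr_le0; apply/ler_addgt0Pr => e e0.
rewrite add0r.
have tri (p q r : R) : `|p - r| < e / 2 -> `|q - r| < e / 2 -> `|p - q| <= e.
  move=> pr qr; rewrite ltW // [e]splitr.
  by rewrite (le_lt_trans (ler_distD r _ _)) // ltrD // distrC.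
have e2 : 0 < e / 2 by rewrite divr_gt0.
have [d1 d10 H1] := second_difference w oD Dx df (ddf v).
have [d2 d20 H2] := second_difference v oD Dx df (ddf w).
have /cvgrPdist_lt/(_ _ e2)/near_line - /(_ v w)[d3 d30 H3] := c1.
have /cvgrPdist_lt/(_ _ e2)/near_line - /(_ w v)[d4 d40 H4] := c2.
pose h := Num.min (Num.min d1 d2) (Num.min d3 d4).
have h0 : 0 < h by rewrite !lt_min d10 d20 d30 d40.
have [hh1 hh2 hh3 hh4] : [/\ h <= d1, h <= d2, h <= d3 & h <= d4].
  by rewrite !ge_min !lexx !orbT.
have [[s t] /= [hs ht] E1] := H1 _ h0 hh1.
have [[s' t'] /= [hs' ht'] E2] := H2 _ h0 hh2.
have := H3 s t (le_trans hs hh3) (le_trans ht hh3).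
have := H4 s' t' (le_trans hs' hh4) (le_trans ht' hh4).
set a := 'D_w _ _ in E1 *; set b := 'D_v _ _ in E2 *.
have -> : a = b.
  have hn : h ^+ 2 != 0 by rewrite expf_neq0 // gt_eqF.
  move: a b E1 E2 => a b E1 E2; apply: (mulfI hn); rewrite -E1 -E2.
  rewrite [h *: w + (h *: v + x)]addrCA; ring.
move=> Hb Ha; exact: (tri _ _ _ Ha Hb).
Qed.

(** Here the innermost derivative is split off, whereas [iterD] exposes the outermost. The sum,
    product and quotient rules then rewrite ['D_v] of a compound function through functions one
    level lower, which is what an induction on [k] needs. Level 0 already asks for
    differentiability, to match [smooth_on]. *)
Fixpoint Ck (k : nat) D f : Prop :=
  (forall x, D x -> differentiable f x) /\
  match k with 0 => True | k'.+1 => forall v, Ck k' D (fun x => 'D_v f x) end.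

Lemma Ck_diff k D f x : Ck k D f -> D x -> differentiable f x.
Proof. by case: k => [|k] [H _]; exact: H. Qed.

Lemma CkW k D f : Ck k.+1 D f -> Ck k D f.
Proof. by elim: k f => [|k IH] f [H1 H2]; split => // v; apply: IH. Qed.

Lemma iterD_rcons vs v f : Defs.iterD (rcons vs v) f = Defs.iterD vs (fun x => 'D_v f x).
Proof. by elim: vs => //= u vs ->. Qed.

Lemma smooth_onP D f : smooth_on D f <-> forall k, Ck k D f.
Proof.
split=> [sf k|cf vs].
  elim: k f sf => [|k IH] f sf; split => //; try exact: (sf [::]).
  by move=> v; apply: IH => vs x Dx; rewrite -iterD_rcons; exact: sf.
elim/last_ind: vs f cf => [|vs v IH] f cf x Dx; first exact: (cf 0%N).1.
rewrite iterD_rcons; apply: IH => // k; exact: (cf k.+1).2.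
Qed.

Lemma smooth_diff D f x : smooth_on D f -> D x -> differentiable f x.
Proof. by move=> sf; apply: (sf [::]). Qed.

Lemma smooth_derivable D f x v : smooth_on D f -> D x -> derivable f x v.
Proof. by move=> sf Dx; apply/diff_derivable/smooth_diff/Dx. Qed.

Lemma smooth_derive D f v : smooth_on D f -> smooth_on D (fun x => 'D_v f x).
Proof. by move=> sf vs x Dx; rewrite -iterD_rcons; apply: sf. Qed.

Lemma smooth_derive_comm D f x v w : open D -> D x -> smooth_on D f ->
  'D_w (fun z => 'D_v f z) x = 'D_v (fun z => 'D_w f z) x.
Proof.
move=> oD Dx sf; apply: (derive_comm oD) => //.
- by move=> y; exact: smooth_diff.
- by move=> u y; apply: smooth_diff; exact: smooth_derive.
- by apply: differentiable_continuous; apply: (sf [:: w; v]).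
- by apply: differentiable_continuous; apply: (sf [:: v; w]).
Qed.

Lemma derive_eq_on D f g x v : open D -> D x -> {in D, f =1 g} ->
  'D_v f x = 'D_v g x.
Proof.
move=> oD Dx fg; apply: near_eq_derive; near=> y; apply: fg.
by rewrite inE; near: y; exact: open_nbhs_nbhs.
Unshelve. all: by end_near. Qed.

End RealSmooth.

(** * Algebraic closure properties of smooth real functions *)

Section SmoothClosure.
Variables (R : realType) (V : normedModType R).
Implicit Types (D : set V) (f g : V -> R) (u v w x : V).

(** The first-order expansion holds with the zero linear map, and uniqueness of the expansion
    identifies that map with the differential. Applied to the difference of two functions that agree
    near a point, this makes differentiability a local notion. *)
Lemma differentiable_near0 f x : (\forall y \near x, f y = 0) -> differentiable f x.
Proof.
move=> f0.
have c0 : continuous (\0%R : {linear V -> R}) by move=> ?; exact: cvg_cst.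
have fo : f \o shift x = cst (f x) + (\0%R : {linear V -> R}) +o_ 0 id.
  apply/eqaddoP => e e0; rewrite (nbhs_singleton f0).
  move: f0; rewrite (near_shift 0 x) subr0 /= => f0.
  near=> h.
  have fh : f (h + x) = 0 by near: h.
  have -> : (f \o shift x - (cst 0 + (\0%R : {linear V -> R}))) h = 0.
    by rewrite !fctE /= fh addr0 subrr.
  by rewrite normr0 mulr_ge0 // ltW.
by apply/diff_locallyP; rewrite (diff_unique c0 fo).
Unshelve. all: by end_near. Qed.

Lemma differentiable_eq_on D f g x : open D -> D x -> {in D, f =1 g} ->
  differentiable f x -> differentiable g x.
Proof.
move=> oD Dx fg df.
have -> : g = f + (g - f) by apply/funext => y; rewrite !fctE addrC subrK.
apply: differentiableD => //; apply: differentiable_near0; near=> y.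
rewrite !fctE fg ?subrr // inE; near: y; exact: open_nbhs_nbhs.
Unshelve. all: by end_near. Qed.

Lemma Ck_eq_on k D f g : open D -> {in D, f =1 g} -> Ck k D f -> Ck k D g.
Proof.
move=> oD; elim: k f g => [|k IH] f g fg [df Cf].
  by split=> // x Dx; apply: differentiable_eq_on fg (df x Dx).
split=> [x Dx|v]; first exact: differentiable_eq_on fg (df x Dx).
apply: IH (Cf v) => x; rewrite inE => Dx; exact: derive_eq_on fg.
Qed.

Lemma CkD k D f g : open D -> Ck k D f -> Ck k D g -> Ck k D (f + g).
Proof.
move=> oD; elim: k f g => [|k IH] f g [df Cf] [dg Cg];
  split=> [x Dx|//]; try exact: differentiableD (df x Dx) (dg x Dx).
move=> v; apply: Ck_eq_on (IH _ _ (Cf v) (Cg v)) => // x; rewrite inE => Dx.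
by rewrite deriveD //; apply: diff_derivable; [exact: df|exact: dg].
Qed.

Lemma CkN k D f : open D -> Ck k D f -> Ck k D (- f).
Proof.
move=> oD; elim: k f => [|k IH] f [df Cf];
  split=> [x Dx|//]; try exact: differentiableN (df x Dx).
move=> v; apply: Ck_eq_on (IH _ (Cf v)) => // x; rewrite inE => Dx.
by rewrite deriveN //; apply: diff_derivable; exact: df.
Qed.

Lemma CkM k D f g : open D -> Ck k D f -> Ck k D g -> Ck k D (f * g).
Proof.
move=> oD; elim: k f g => [|k IH] f g Cf Cg; split=> [x Dx|//];
  try exact: differentiableM (Ck_diff Cf Dx) (Ck_diff Cg Dx).
move=> v; apply: (@Ck_eq_on k D (f * (fun x => 'D_v g x) + g * (fun x => 'D_v f x))) => //.
  move=> x; rewrite inE => Dx; rewrite deriveM //; apply: diff_derivable.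
    exact: Ck_diff Cf Dx.
  exact: Ck_diff Cg Dx.
apply: CkD => //; apply: IH; [exact: CkW|exact: Cg.2|exact: CkW|exact: Cf.2].
Qed.

Lemma Ck_cst k D (c : R) : open D -> Ck k D (cst c).
Proof.
move=> oD; elim: k c => [|k IH] c; split=> // v.
by apply: Ck_eq_on (IH 0) => // x _; rewrite /= derive_cst.
Qed.

Lemma CkV k D f : open D -> (forall x, D x -> f x != 0) -> Ck k D f ->
  Ck k D (fun x => (f x)^-1).
Proof.
move=> oD f0; elim: k => [|k IH] Cf; split=> [x Dx|//];
  try exact: differentiableV (Ck_diff Cf Dx) (f0 x Dx).
(* The derivative of [1/f] is [- f^-2 * 'D_v f], which contains [1/f] again; one level lower it is
   supplied by the induction hypothesis. *)
have Ci := IH (CkW Cf) => v.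
apply: Ck_eq_on (CkN oD (CkM oD (CkM oD Ci Ci) (Cf.2 v))) => // x; rewrite inE => Dx.
rewrite deriveV ?f0 //; last by apply: diff_derivable; exact: Ck_diff Cf Dx.
by rewrite !fctE /= scaleNr -exprVn expr2.
Qed.

Lemma smooth_eq_on D f g : open D -> {in D, f =1 g} -> smooth_on D f -> smooth_on D g.
Proof.
by move=> oD fg /smooth_onP sf; apply/smooth_onP => k; exact: Ck_eq_on fg (sf k).
Qed.

Lemma smoothD D f g : open D -> smooth_on D f -> smooth_on D g -> smooth_on D (f + g).
Proof. by move=> oD /smooth_onP sf /smooth_onP sg; apply/smooth_onP => k; exact: CkD. Qed.

Lemma smoothN D f : open D -> smooth_on D f -> smooth_on D (- f).
Proof. by move=> oD /smooth_onP sf; apply/smooth_onP => k; exact: CkN. Qed.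

Lemma smoothM D f g : open D -> smooth_on D f -> smooth_on D g -> smooth_on D (f * g).
Proof. by move=> oD /smooth_onP sf /smooth_onP sg; apply/smooth_onP => k; exact: CkM. Qed.

Lemma smoothV D f : open D -> (forall x, D x -> f x != 0) -> smooth_on D f ->
  smooth_on D (fun x => (f x)^-1).
Proof. by move=> oD f0 /smooth_onP sf; apply/smooth_onP => k; exact: CkV. Qed.

Lemma smooth_cst D (c : R) : open D -> smooth_on D (cst c).
Proof. by move=> oD; apply/smooth_onP => k; exact: Ck_cst. Qed.

End SmoothClosure.

(** * Pullback of smooth functions along continuous linear maps *)

Section SmoothPullback.
Variables (R : realType) (V W : normedModType R) (L : {linear V -> W}).
Hypothesis cL : continuous L.

(** By linearity the two difference quotients are the same function of [h], so no chain rule and no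
    differentiability of [f] is involved. *)
Lemma derive_pullback (f : W -> R) v x : 'D_v (f \o L) x = 'D_(L v) f (L x).
Proof.
rewrite /derive [X in lim (X @ _)](_ : _ =
  (fun h : R => h^-1 *: ((f \o shift (L x)) (h *: L v) - f (L x)))) //.
by apply/funext => h /=; rewrite [L (_ + _)]linearD [L (_ *: _)]linearZ.
Qed.

Lemma smooth_pullback (D : set V) (E : set W) (f : W -> R) :
  (forall x, D x -> E (L x)) -> smooth_on E f -> smooth_on D (f \o L).
Proof.
move=> DE sf; apply/smooth_onP => k; move/smooth_onP: sf => /(_ k).
elim: k f => [|k IH] f Cf; split=> [x Dx|//];
  try (apply: differentiable_comp; [exact: linear_differentiable|exact: Ck_diff Cf (DE _ Dx)]).
move=> v; rewrite (_ : (fun _ => _) = (fun y => 'D_(L v) f y) \o L).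
  exact: IH (Cf.2 _).
by apply/funext => x; rewrite derive_pullback.
Qed.

End SmoothPullback.

(** * Smooth complex-valued functions and abstract derivations *)

Section ComplexSmooth.
Variables (R : realType) (V : normedModType R).
Local Notation C := (R[i]).
Implicit Types (F G : V -> C) (u v w x : V).

Definition smoothC (D : set V) F : Prop :=
  smooth_on D (fun x => complex.Re (F x)) /\ smooth_on D (fun x => complex.Im (F x)).

Lemma pdCE v F x :
  pdC v F x = Complex ('D_v (fun y => complex.Re (F y)) x)
                      ('D_v (fun y => complex.Im (F y)) x).
Proof.
rewrite /pdC; set a := 'D_v _ x; set b := 'D_v _ x.
by rewrite [RHS]complexE.
Qed.

Lemma Re_mul (a b : C) : complex.Re (a * b) =
  complex.Re a * complex.Re b - complex.Im a * complex.Im b.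
Proof. by case: a b => [a1 a2] [b1 b2]. Qed.

Lemma Im_mul (a b : C) : complex.Im (a * b) =
  complex.Re a * complex.Im b + complex.Im a * complex.Re b.
Proof. by case: a b => [a1 a2] [b1 b2]. Qed.

Lemma Re_add (a b : C) : complex.Re (a + b) = complex.Re a + complex.Re b.
Proof. by case: a b => [a1 a2] [b1 b2]. Qed.

Lemma Im_add (a b : C) : complex.Im (a + b) = complex.Im a + complex.Im b.
Proof. by case: a b => [a1 a2] [b1 b2]. Qed.

Variable D : set V.
Hypothesis oD : open D.

Lemma smoothC_eq_on F G : (forall x, D x -> F x = G x) -> smoothC D F -> smoothC D G.
Proof.
move=> FG [s1 s2]; split.
  by apply: smooth_eq_on s1 => // x; rewrite inE => Dx; rewrite FG.
by apply: smooth_eq_on s2 => // x; rewrite inE => Dx; rewrite FG.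
Qed.

Lemma smoothC_cst (c : C) : smoothC D (fun=> c).
Proof. by split; exact: smooth_cst. Qed.

Lemma smoothC_add F G : smoothC D F -> smoothC D G -> smoothC D (fun x => F x + G x).
Proof.
move=> [F1 F2] [G1 G2]; split.
  by apply: smooth_eq_on (smoothD oD F1 G1) => // x _; rewrite Re_add.
by apply: smooth_eq_on (smoothD oD F2 G2) => // x _; rewrite Im_add.
Qed.

Lemma smoothC_mul F G : smoothC D F -> smoothC D G -> smoothC D (fun x => F x * G x).
Proof.
move=> [F1 F2] [G1 G2]; split.
  apply: smooth_eq_on (smoothD oD (smoothM oD F1 G1) (smoothN oD (smoothM oD F2 G2))) => // x _.
  by rewrite Re_mul.
apply: smooth_eq_on (smoothD oD (smoothM oD F1 G2) (smoothM oD F2 G1)) => // x _.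
by rewrite Im_mul.
Qed.

Lemma smoothC_opp F : smoothC D F -> smoothC D (fun x => - F x).
Proof.
move=> sF; apply: smoothC_eq_on (smoothC_mul (smoothC_cst (-1)) sF) => x _.
by rewrite mulN1r.
Qed.

Lemma smoothC_sum (I : Type) (r : seq I) (P : pred I) (F : I -> V -> C) :
  (forall i, smoothC D (F i)) -> smoothC D (fun x => \sum_(i <- r | P i) F i x).
Proof.
move=> sF; elim: r => [|i r IH].
  by apply: smoothC_eq_on (smoothC_cst 0) => x _; rewrite big_nil.
case Pi: (P i); last by apply: smoothC_eq_on IH => x _; rewrite big_cons Pi.
by apply: smoothC_eq_on (smoothC_add (sF i) IH) => x _; rewrite big_cons Pi.
Qed.

Lemma smoothC_prod (I : Type) (r : seq I) (P : pred I) (F : I -> V -> C) :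
  (forall i, smoothC D (F i)) -> smoothC D (fun x => \prod_(i <- r | P i) F i x).
Proof.
move=> sF; elim: r => [|i r IH].
  by apply: smoothC_eq_on (smoothC_cst 1) => x _; rewrite big_nil.
case Pi: (P i); last by apply: smoothC_eq_on IH => x _; rewrite big_cons Pi.
by apply: smoothC_eq_on (smoothC_mul (sF i) IH) => x _; rewrite big_cons Pi.
Qed.

Lemma smoothC_conj F : smoothC D F -> smoothC D (fun x => (F x)^*%C).
Proof.
move=> [F1 F2]; split.
  by apply: smooth_eq_on F1 => // x _; case: (F x).
by apply: smooth_eq_on (smoothN oD F2) => // x _; rewrite fctE; case: (F x).
Qed.

Lemma smoothC_inv F : (forall x, D x -> F x != 0) -> smoothC D F ->
  smoothC D (fun x => (F x)^-1).
Proof.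
move=> F0 sF; have [s1 s2] := sF.
(* The inverse is the conjugate divided by the squared modulus [N], which reduces the claim to
   inversion of a real function. *)
pose N x := complex.Re (F x) ^+ 2 + complex.Im (F x) ^+ 2.
have N0 x : D x -> N x != 0.
  move=> Dx; have := F0 x Dx; rewrite /N; case: (F x) => a b /=; apply: contra.
  by rewrite paddr_eq0 ?sqr_ge0 // !sqrf_eq0 eq_complex.
have sN : smooth_on D N.
  by apply: smooth_eq_on (smoothD oD (smoothM oD s1 s1) (smoothM oD s2 s2)) => // x _.
have sNi : smoothC D (fun x => ((N x)^-1)%:C%C).
  by split; [exact: smoothV N0 sN|exact: smooth_cst].
apply: smoothC_eq_on (smoothC_mul sNi (smoothC_conj sF)) => x Dx.
apply: (mulIf (F0 x Dx)); rewrite mulVf ?F0 //.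
have := N0 x Dx; rewrite /N; case: (F x) => a b /= n0.
by apply/eqP; rewrite eq_complex /=; apply/andP; split; apply/eqP; field.
Qed.

Lemma smoothC_det n (F : 'I_n -> 'I_n -> V -> C) : (forall i j, smoothC D (F i j)) ->
  smoothC D (fun x => \det (\matrix_(i, j) F i j x)).
Proof.
move=> sF; apply: smoothC_sum => s; apply: smoothC_mul; first exact: smoothC_cst.
have S := @smoothC_prod _ (index_enum 'I_n) xpredT
  (fun i => F i (s i)) (fun i => sF i (s i)).
apply: (smoothC_eq_on _ S) => x _.
by apply: eq_bigr => i _; rewrite mxE.
Qed.

(** Cramer's rule: each entry of the inverse is a cofactor, polynomial in the entries of [F],
    divided by a determinant that does not vanish on [D]. *)
Lemma smoothC_invmx n (F : V -> 'M[C]_n) i j : (forall i j, smoothC D (fun x => F x i j)) ->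
  (forall x, D x -> F x \in unitmx) -> smoothC D (fun x => invmx (F x) i j).
Proof.
move=> sF uF.
have sd : smoothC D (fun x => \det (F x)).
  apply: smoothC_eq_on (smoothC_det sF) => x _; congr (\det _).
  by apply/matrixP => a b; rewrite mxE.
have sa : smoothC D (fun x => \adj (F x) i j).
  apply: smoothC_eq_on (_ : smoothC D (fun x => cofactor (F x) j i)) => [x _|].
    by rewrite mxE.
  apply: smoothC_mul; first exact: smoothC_cst.
  apply: smoothC_eq_on (@smoothC_det _ (fun a b x => F x (lift j a) (lift i b)) _).
    by move=> x _; congr (\det _); apply/matrixP => a b; rewrite !mxE.
  by move=> a b; exact: sF.
apply: smoothC_eq_on (smoothC_mul (smoothC_inv _ sd) sa) => x Dx.
  by rewrite /invmx uF // [RHS]mxE.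
by rewrite -unitfE -unitmxE uF.
Qed.

Lemma smoothC_pdC v F : smoothC D F -> smoothC D (pdC v F).
Proof.
move=> [s1 s2]; split.
  by apply: smooth_eq_on (smooth_derive v s1) => // x _; rewrite pdCE.
by apply: smooth_eq_on (smooth_derive v s2) => // x _; rewrite pdCE.
Qed.

Lemma pdC_eq_on v F G x : D x -> (forall y, D y -> F y = G y) -> pdC v F x = pdC v G x.
Proof.
move=> Dx FG; rewrite !pdCE; congr Complex; apply: (derive_eq_on _ oD Dx) => y;
  by rewrite inE => Dy; rewrite FG.
Qed.

Lemma pdC_add v F G x : D x -> smoothC D F -> smoothC D G ->
  pdC v (fun y => F y + G y) x = pdC v F x + pdC v G x.
Proof.
move=> Dx [F1 F2] [G1 G2]; rewrite !pdCE; apply/eqP; rewrite eq_complex /=.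
apply/andP; split; apply/eqP.
  rewrite -deriveD; try exact: smooth_derivable Dx.
  by congr ('D_v _ x); apply/funext => y; rewrite Re_add.
rewrite -deriveD; try exact: smooth_derivable Dx.
by congr ('D_v _ x); apply/funext => y; rewrite Im_add.
Qed.

Lemma pdC_mul v F G x : D x -> smoothC D F -> smoothC D G ->
  pdC v (fun y => F y * G y) x = pdC v F x * G x + F x * pdC v G x.
Proof.
move=> Dx [F1 F2] [G1 G2].
have dF1 := @smooth_derivable _ _ _ _ _ v F1 Dx; have dF2 := @smooth_derivable _ _ _ _ _ v F2 Dx.
have dG1 := @smooth_derivable _ _ _ _ _ v G1 Dx; have dG2 := @smooth_derivable _ _ _ _ _ v G2 Dx.
have E (a b c d : V -> R) : derivable a x v -> derivable b x v -> derivable c x v ->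
    derivable d x v -> 'D_v (a * b + c * d) x =
    (a x * 'D_v b x + b x * 'D_v a x) + (c x * 'D_v d x + d x * 'D_v c x).
  move=> da db dc dd.
  by rewrite (deriveD (derivableM da db) (derivableM dc dd)) (deriveM da db) (deriveM dc dd).
have -> : pdC v (fun y => F y * G y) x = Complex
   ('D_v ((fun y => complex.Re (F y)) * (fun y => complex.Re (G y)) +
         (- (fun y => complex.Im (F y))) * (fun y => complex.Im (G y))) x)
   ('D_v ((fun y => complex.Re (F y)) * (fun y => complex.Im (G y)) +
         (fun y => complex.Im (F y)) * (fun y => complex.Re (G y))) x).
  rewrite pdCE; congr (Complex ('D_v _ x) ('D_v _ x)); apply/funext => y.
    by rewrite Re_mul -mulNr.
  by rewrite Im_mul.
rewrite (E _ _ _ _ dF1 dG1 (derivableN dF2) dG2) (E _ _ _ _ dF1 dG2 dF2 dG1).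
rewrite (deriveN dF2) !pdCE.
have -> : (- (fun y => complex.Im (F y))) x = - complex.Im (F x) by [].
case: (F x) (G x) => [a1 a2] [b1 b2] /=.
by apply/eqP; rewrite eq_complex /=; apply/andP; split; apply/eqP; ring.
Qed.

Lemma pdC_conj v F x : D x -> smoothC D F -> pdC v (fun y => (F y)^*%C) x = (pdC v F x)^*%C.
Proof.
move=> Dx [F1 F2]; rewrite !pdCE /= -deriveN; last exact: smooth_derivable Dx.
by congr (Complex ('D_v _ x) ('D_v _ x)); apply/funext => y; rewrite ?fctE; case: (F y).
Qed.

Lemma pdC_comm v w F x : D x -> smoothC D F -> pdC w (pdC v F) x = pdC v (pdC w F) x.
Proof.
move=> Dx [F1 F2]; rewrite !(pdCE _ (pdC _ _)).
have rE u u' : 'D_u' (fun y => complex.Re (pdC u F y)) x =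
    'D_u' (fun z => 'D_u (fun y => complex.Re (F y)) z) x.
  by congr ('D_u' _ x); apply/funext => y; rewrite pdCE.
have iE u u' : 'D_u' (fun y => complex.Im (pdC u F y)) x =
    'D_u' (fun z => 'D_u (fun y => complex.Im (F y)) z) x.
  by congr ('D_u' _ x); apply/funext => y; rewrite pdCE.
apply: f_equal2.
  by apply: etrans (rE v w) (etrans _ (esym (rE w v))); exact: smooth_derive_comm F1.
by apply: etrans (iE v w) (etrans _ (esym (iE w v))); exact: smooth_derive_comm F2.
Qed.

(** Functions are total but the geometric identities hold on [D] only; [der_eq_on] is the locality
    that allows such identities to be differentiated. Directional and Wirtinger derivatives and the
    two leaf fields are all handled through this interface. *)
Record derivation (L : (V -> C) -> V -> C) : Prop := Derivation {
  der_smooth : forall F, smoothC D F -> smoothC D (L F);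
  der_eq_on : forall F G x, D x -> (forall y, D y -> F y = G y) -> L F x = L G x;
  der_add : forall F G x, D x -> smoothC D F -> smoothC D G ->
    L (fun y => F y + G y) x = L F x + L G x;
  der_mul : forall F G x, D x -> smoothC D F -> smoothC D G ->
    L (fun y => F y * G y) x = L F x * G x + F x * L G x }.

Lemma der0 L x : derivation L -> D x -> L (fun=> 0) x = 0.
Proof.
move=> dL Dx; have s0 := smoothC_cst 0.
have := der_add dL Dx s0 s0; rewrite (der_eq_on dL (G := fun=> 0) Dx) ?addr0 //.
by move/eqP; rewrite -subr_eq subrr eq_sym => /eqP.
Qed.

Lemma der1 L x : derivation L -> D x -> L (fun=> 1) x = 0.
Proof.
move=> dL Dx; have s0 := smoothC_cst 1.
have := der_mul dL Dx s0 s0; rewrite (der_eq_on dL (G := fun=> 1) Dx).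
  by move/eqP; rewrite mulr1 mul1r -subr_eq subrr eq_sym => /eqP.
by move=> *; rewrite mulr1.
Qed.

Lemma der_opp L F x : derivation L -> D x -> smoothC D F -> L (fun y => - F y) x = - L F x.
Proof.
move=> dL Dx sF; apply/eqP; rewrite -addr_eq0; apply/eqP.
rewrite -(der_add dL Dx (smoothC_opp sF) sF) -(der0 dL Dx).
by apply: (der_eq_on dL Dx) => y _; rewrite addNr.
Qed.

Lemma der_sum (I : Type) (r : seq I) (P : pred I) (F : I -> V -> C) L x :
  derivation L -> D x -> (forall i, smoothC D (F i)) ->
  L (fun y => \sum_(i <- r | P i) F i y) x = \sum_(i <- r | P i) L (F i) x.
Proof.
move=> dL Dx sF; elim: r => [|i r IH].
  rewrite big_nil -[RHS](der0 dL Dx).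
  by apply: (der_eq_on dL Dx) => y _; rewrite big_nil.
rewrite big_cons; case Pi: (P i); rewrite -IH; last first.
  by apply: (der_eq_on dL Dx) => y _; rewrite big_cons Pi.
rewrite -(der_add dL Dx) //; last exact: smoothC_sum.
by apply: (der_eq_on dL Dx) => y _; rewrite big_cons Pi.
Qed.

Lemma derivation_sum (I : finType) (L : I -> (V -> C) -> V -> C) (a : I -> V -> C) :
  (forall i, derivation (L i)) -> (forall i, smoothC D (a i)) ->
  derivation (fun F x => \sum_i a i x * L i F x).
Proof.
move=> dL sa; split=> [F sF|F G x Dx FG|F G x Dx sF sG|F G x Dx sF sG].
- by apply: smoothC_sum => i; apply: smoothC_mul => //; exact: der_smooth.
- by apply: eq_bigr => i _; rewrite (der_eq_on (dL i) Dx FG).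
- by rewrite -big_split; apply: eq_bigr => i _; rewrite /= (der_add (dL i)) // mulrDr.
rewrite mulr_suml mulr_sumr -big_split; apply: eq_bigr => i _ /=.
by rewrite (der_mul (dL i)) //; ring.
Qed.

End ComplexSmooth.

(** * Positive traces relative to a hermitian metric *)

Section PosdefTraces.
Variable C : numClosedFieldType.
Local Open Scope sesquilinear_scope.
Local Notation conjmx A := (map_mx Num.conj A).

Definition posdefmx n (G : 'M[C]_n) :=
  G^t* = G /\ forall v : 'rV_n, v != 0 -> 0 < (v *m G *m v^t*) 0 0.

(** By the spectral theorem [G] is [P^t* *m diag_mx d *m P] with [P] unitary and [d] positive; then
    [W] is [P^t*] times the diagonal of inverse square roots. Its columns form a frame orthonormal
    for [G], in which traces become squared norms. *)
Lemma posdefmx_inv n (G : 'M[C]_n) : posdefmx G ->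
  G \in unitmx /\ exists W : 'M[C]_n, invmx G = W *m W^t*.
Proof.
move=> [Gh Gp].
have /orthomx_spectralP : G \is normalmx by apply/normalmxP; rewrite Gh.
set P := spectralmx G; set d := spectral_diag G.
have uP : P \is unitarymx by exact: spectral_unitarymx.
rewrite invmx_unitary // => GE.
have PPs : P *m P^t* = 1%:M by apply/unitarymxP.
have PsP : P^t* *m P = 1%:M by exact: mulmx1C.
have dE : P *m G *m P^t* = diag_mx d by rewrite GE !mulmxA PPs mul1mx -mulmxA PPs mulmx1.
have d0 i : 0 < d 0 i.
  have -> : d 0 i = (row i P *m G *m (row i P)^t*) 0 0.
    rewrite -row_mul tr_row map_col -row_mul.
    have -> : d 0 i = diag_mx d i i by rewrite mxE eqxx.
    by rewrite -dE !mxE; apply: eq_bigr => k _; rewrite !mxE.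
  apply: Gp; apply/eqP => r0; have := congr1 (fun X => row i X) PPs.
  rewrite row_mul r0 mul0mx row1 => /matrixP/(_ 0 i); rewrite !mxE !eqxx /=.
  by move/esym/eqP; rewrite oner_eq0.
pose s : 'rV_n := \row_i (sqrtC (d 0 i))^-1.
have ss : (diag_mx s)^t* = diag_mx s.
  rewrite tr_diag_mx map_diag_mx; congr diag_mx; apply/rowP => i; rewrite !mxE.
  by apply/CrealP; rewrite rpredV ger0_real // sqrtC_ge0 ltW.
pose W := P^t* *m diag_mx s.
have GW : G *m (W *m W^t*) = 1%:M.
  rewrite /W trmx_mul map_mxM ss trmxCK GE !mulmxA -[_ *m P *m P^t*]mulmxA PPs mulmx1.
  have -> : P^t* *m diag_mx d *m diag_mx s *m diag_mx s = P^t*.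
    rewrite -!mulmxA !mulmx_diag -[RHS]mulmx1; congr (_ *m _).
    apply/matrixP => i j; rewrite !mxE; case: (i == j) => //=.
    rewrite !mulr1n -invfM -expr2 sqrtCK mulfV // gt_eqF //.
  exact: PsP.
have [uG _] := mulmx1_unit GW; split=> //; exists W.
by rewrite -[RHS](mulKmx uG) GW mulmx1.
Qed.

Lemma mxtrace_ctmul_ge0 m n (Y : 'M[C]_(m, n)) : 0 <= \tr (Y^t* *m Y).
Proof.
apply: sumr_ge0 => i _; rewrite mxE; apply: sumr_ge0 => j _.
by rewrite !mxE mulrC mul_conjC_ge0.
Qed.

Lemma trmxC_mul m n p (A : 'M[C]_(m, n)) (B : 'M[C]_(n, p)) :
  (A *m B)^t* = B^t* *m A^t*.
Proof. by rewrite trmx_mul map_mxM. Qed.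

Section SymmetricMaps.
Variables (n : nat) (G W : 'M[C]_n).
Hypotheses (Gh : G^t* = G) (uG : G \in unitmx) (invG : invmx G = W *m W^t*).

Lemma conjmx_symE A : (A^T *m G)^T = A^T *m G ->
  conjmx A = W *m W^t* *m (A^T *m G)^t*.
Proof.
move=> sA; rewrite trmx_mul map_mxM Gh trmxK -invG mulKmx //.
Qed.

(** Lowering an index turns [A] into the bilinear form [B = A^T *m G]. In the frame [W] its matrix
    is [W^T *m B *m W], and symmetry of [B] makes the trace the squared Frobenius norm of that
    matrix. *)
Lemma mxtrace_conj_mul_ge0 A : (A^T *m G)^T = A^T *m G -> 0 <= \tr (conjmx A *m A).
Proof.
move=> sA; have Ac := conjmx_symE sA.
move: (A^T *m G) sA Ac => B sA Ac.
have AE : A = conjmx W *m W^T *m B.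
  have := congr1 (fun X => conjmx X) Ac; rewrite !map_mxM -!map_mx_comp.
  rewrite !(map_mx_id (conjCK (C:=C))) => ->; congr (_ *m _ *m _).
  exact: sA.
have -> : \tr (conjmx A *m A) = \tr ((W^T *m B *m W)^t* *m (W^T *m B *m W)).
  rewrite {1}Ac AE !trmx_mul !map_mxM trmxK -!mulmxA mxtrace_mulC.
  by rewrite /= !mulmxA.
exact: mxtrace_ctmul_ge0.
Qed.

(** [Z] is the endomorphism [N] expressed in the orthonormal frame [W]: it is hermitian, so the
    trace of its square is a squared Frobenius norm. *)
Lemma mxtrace_selfadj_ge0 N : (G *m N)^t* = G *m N -> 0 <= \tr (N *m N).
Proof.
move=> hN; pose Z := W^t* *m (G *m N) *m W.
have NE : N = W *m W^t* *m (G *m N) by rewrite -invG mulKmx.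
have Zh : Z^t* = Z by rewrite /Z 2!trmxC_mul trmxCK hN mulmxA.
have -> : \tr (N *m N) = \tr (Z^t* *m Z).
  have -> : N *m N = W *m W^t* *m (G *m N) *m (W *m W^t* *m (G *m N)) by rewrite -NE.
  by rewrite Zh /Z -!mulmxA mxtrace_mulC !mulmxA.
exact: mxtrace_ctmul_ge0.
Qed.

End SymmetricMaps.

(* Cauchy-Schwarz for [N = conj A * A], which is self-adjoint with respect to [G]. *)
Lemma posdefmx_trace_ineq n (G A Q : 'M[C]_n) : (0 < n)%N -> posdefmx G ->
  (A^T *m G)^T = A^T *m G -> (Q^T *m G)^T = Q^T *m G ->
  2%:R / n%:R * \tr (conjmx A *m A) ^+ 2 <=
  2%:R * \tr (conjmx A *m A *m (conjmx A *m A)) + \tr (conjmx Q *m Q).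
Proof.
move=> n0 pG sA sQ; have [uG [W invG]] := posdefmx_inv pG; have Gh := pG.1.
have Q0 := mxtrace_conj_mul_ge0 Gh uG invG sQ.
have A0 := mxtrace_conj_mul_ge0 Gh uG invG sA.
set N := conjmx A *m A; set t := \tr N.
have nn : (n%:R : C) != 0 by rewrite pnatr_eq0 -lt0n.
(* [c] is the mean eigenvalue of [N]. Subtracting [c%:M] preserves self-adjointness only because [c]
   is real, which is where [A0] enters; the square of the traceless part then gives
   Cauchy-Schwarz. *)
pose c := t / n%:R.
have cr : c^* = c by apply/CrealP/ger0_real; rewrite divr_ge0 // ler0n.
have GN : (G *m N)^t* = G *m N.
  rewrite /N; have -> : G *m (conjmx A *m A) = (A^T *m G)^t* *m A.
    by rewrite trmx_mul map_mxM Gh trmxK mulmxA.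
  have Gc : conjmx G = G^T by rewrite -[in RHS]Gh -map_trmx trmxK.
  have Sc : (A^T *m G)^t* = A^t* *m G^T by rewrite sA map_mxM Gc.
  rewrite trmxC_mul trmxCK Sc.
  by rewrite -[in LHS]sA trmx_mul trmxK mulmxA.
have N0 : 0 <= \tr ((N - c%:M) *m (N - c%:M)).
  apply: (mxtrace_selfadj_ge0 uG invG).
  rewrite mulmxBr linearB /= map_mxB GN mul_mx_scalar linearZ /= map_mxZ.
  by rewrite /= cr Gh.
have : 0 <= \tr (N *m N) - t ^+ 2 / n%:R.
  have -> : \tr (N *m N) - t ^+ 2 / n%:R = \tr ((N - c%:M) *m (N - c%:M)) => //.
  rewrite mulmxBr !mulmxBl !mul_mx_scalar mul_scalar_mx.
  rewrite !linearB /= !mxtraceZ mxtrace_scalar -/t /c -mulr_natr.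
  by field.
rewrite subr_ge0 => CS; rewrite -[leLHS]addr0 lerD //.
by rewrite mulrAC -mulrA ler_pM2l.
Qed.

End PosdefTraces.

(** * Entrywise derivations of matrix-valued functions *)

Section MatrixDerivation.
Variables (R : realType) (V : normedModType R) (D : set V).
Hypothesis oD : open D.
Local Notation C := (R[i]).

Definition smoothmx m n (M : V -> 'M[C]_(m, n)) : Prop :=
  forall a b, smoothC D (fun x => M x a b).

Definition dmx (L : (V -> C) -> V -> C) m n (M : V -> 'M[C]_(m, n)) (x : V) :
    'M[C]_(m, n) := \matrix_(a, b) L (fun y => M y a b) x.

Lemma smoothmx_mul m n p (M : V -> 'M[C]_(m, n)) (N : V -> 'M[C]_(n, p)) :
  smoothmx M -> smoothmx N -> smoothmx (fun x => M x *m N x).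
Proof.
move=> sM sN a b.
have S := smoothC_sum oD (index_enum 'I_n) xpredT
  (fun j => smoothC_mul oD (sM a j) (sN j b)).
by apply: (smoothC_eq_on oD _ S) => x _; rewrite mxE.
Qed.

Lemma smoothmx_opp m n (M : V -> 'M[C]_(m, n)) : smoothmx M -> smoothmx (fun x => - M x).
Proof.
move=> sM a b; apply: (smoothC_eq_on oD _ (smoothC_opp oD (sM a b))) => x _.
by rewrite mxE.
Qed.

Lemma smoothmx_conj m n (M : V -> 'M[C]_(m, n)) :
  smoothmx M -> smoothmx (fun x => map_mx conjc (M x)).
Proof.
move=> sM a b; apply: (smoothC_eq_on oD _ (smoothC_conj oD (sM a b))) => x _.
by rewrite mxE.
Qed.

Lemma smoothmx_tr m n (M : V -> 'M[C]_(m, n)) : smoothmx M -> smoothmx (fun x => (M x)^T).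
Proof.
move=> sM a b; apply: (smoothC_eq_on oD _ (sM b a)) => x _.
by rewrite mxE.
Qed.

Variable L : (V -> C) -> V -> C.
Hypothesis dL : derivation D L.

Lemma smoothmx_dmx m n (M : V -> 'M[C]_(m, n)) : smoothmx M -> smoothmx (dmx L M).
Proof.
move=> sM a b; apply: (smoothC_eq_on oD _ (der_smooth dL (sM a b))) => x _.
by rewrite mxE.
Qed.

Lemma dmx_eq_on m n (M N : V -> 'M[C]_(m, n)) x : D x ->
  (forall y, D y -> M y = N y) -> dmx L M x = dmx L N x.
Proof.
move=> Dx MN; apply/matrixP => a b; rewrite !mxE; apply: (der_eq_on dL Dx) => y Dy.
by rewrite MN.
Qed.

Lemma dmx_add m n (M N : V -> 'M[C]_(m, n)) x : D x -> smoothmx M -> smoothmx N ->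
  dmx L (fun y => M y + N y) x = dmx L M x + dmx L N x.
Proof.
move=> Dx sM sN; apply/matrixP => a b; rewrite !mxE -(der_add dL Dx) //.
by apply: (der_eq_on dL Dx) => y _; rewrite mxE.
Qed.

Lemma dmx_opp m n (M : V -> 'M[C]_(m, n)) x : D x -> smoothmx M ->
  dmx L (fun y => - M y) x = - dmx L M x.
Proof.
move=> Dx sM; apply/matrixP => a b; rewrite !mxE -(der_opp oD dL Dx) //.
by apply: (der_eq_on dL Dx) => y _; rewrite mxE.
Qed.

Lemma dmx_tr m n (M : V -> 'M[C]_(m, n)) x : D x ->
  dmx L (fun y => (M y)^T) x = (dmx L M x)^T.
Proof.
move=> Dx; apply/matrixP => a b; rewrite !mxE.
by apply: (der_eq_on dL Dx) => y _; rewrite mxE.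
Qed.

Lemma dmx_mul m n p (M : V -> 'M[C]_(m, n)) (N : V -> 'M[C]_(n, p)) x : D x ->
  smoothmx M -> smoothmx N ->
  dmx L (fun y => M y *m N y) x = dmx L M x *m N x + M x *m dmx L N x.
Proof.
move=> Dx sM sN; apply/matrixP => a b; rewrite !mxE -big_split /=.
transitivity (L (fun y => \sum_j M y a j * N y j b) x).
  by apply: (der_eq_on dL Dx) => y _; rewrite mxE.
have S := @der_sum _ _ _ oD _ (index_enum 'I_n) xpredT
  (fun j y => M y a j * N y j b) L x dL Dx
  (fun j => smoothC_mul oD (sM a j) (sN j b)).
rewrite S; apply: eq_bigr => j _.
by rewrite (der_mul dL Dx) // !mxE.
Qed.

Lemma der_mxtrace n (M : V -> 'M[C]_n) x : D x -> smoothmx M ->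
  L (fun y => \tr (M y)) x = \tr (dmx L M x).
Proof.
move=> Dx sM.
have S := @der_sum _ _ _ oD _ (index_enum 'I_n) xpredT
  (fun j y => M y j j) L x dL Dx (fun j => sM j j).
by rewrite /mxtrace S; apply: eq_bigr => i _; rewrite mxE.
Qed.

End MatrixDerivation.

(** * The foliation of a degenerate closed hermitian form *)

Section MongeAmpereFoliation.
Variables (R : realType) (V : normedModType R) (D : set V) (n : nat).
Hypothesis oD : open D.
Local Notation C := (R[i]).
Local Notation up := (lift ord0).
Local Notation cj M := (map_mx conjc M).

(* [d] and [db] stand for the Wirtinger derivatives, index 0 being the base
   coordinate z; [H] and [E] stand for the degenerate form and for eta. *)
Variables (d db : 'I_n.+1 -> (V -> C) -> V -> C).
Hypothesis der_d : forall j, derivation D (d j).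
Hypothesis der_db : forall j, derivation D (db j).
Hypothesis d_db : forall j k F x, D x -> smoothC D F -> d j (db k F) x = db k (d j F) x.
Hypothesis d_d : forall j k F x, D x -> smoothC D F -> d j (d k F) x = d k (d j F) x.
Hypothesis d_conj : forall j F x, D x -> smoothC D F ->
  d j (fun y => (F y)^*%C) x = (db j F x)^*%C.

Lemma db_conj j F x : D x -> smoothC D F -> db j (fun y => (F y)^*%C) x = (d j F x)^*%C.
Proof.
move=> Dx sF; rewrite -[LHS]conjcK -d_conj //; last exact: smoothC_conj.
by congr (_^*%C); apply: (der_eq_on (der_d j) Dx) => y _; rewrite conjcK.
Qed.

Lemma db_db j k F x : D x -> smoothC D F -> db j (db k F) x = db k (db j F) x.
Proof.
move=> Dx sF.
have E i y : D y -> db i F y = (d i (fun z => (F z)^*%C) y)^*%C.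
  by move=> Dy; rewrite d_conj // conjcK.
have sFc := smoothC_conj oD sF.
rewrite (der_eq_on (der_db j) Dx (E k)) (der_eq_on (der_db k) Dx (E j)).
rewrite !db_conj //; [|exact: der_smooth (der_d j) _ _|exact: der_smooth (der_d k) _ _].
by rewrite d_d.
Qed.

Variables (H : 'I_n.+1 -> 'I_n.+1 -> V -> C) (E : 'I_n -> V -> C).
Hypothesis sH : forall j k, smoothC D (H j k).
Hypothesis sE : forall a, smoothC D (E a).
Hypothesis H_herm : forall j k x, D x -> H k j x = (H j k x)^*%C.
Hypothesis H_closed : forall i j k x, D x -> d i (H j k) x = d j (H i k) x.

(** The constant component 1 in direction z is included so that the kernel relation and closedness
    can be contracted over all [n.+1] indices at once. *)
Definition leafvec (j : 'I_n.+1) (x : V) : C :=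
  if unlift ord0 j is Some a then E a x else 1.
Local Notation W := leafvec.

Hypothesis H_ker : forall k x, D x -> \sum_j W j x * H j k x = 0.
Definition gmx (x : V) : 'M[C]_n := \matrix_(a, b) H (up a) (up b) x.
Hypothesis gpos : forall x, D x -> posdefmx (gmx x).

Lemma leafvec0 x : W ord0 x = 1. Proof. by rewrite /W unlift_none. Qed.
Lemma leafvec_up a x : W (up a) x = E a x. Proof. by rewrite /W liftK. Qed.

Lemma leafvec0E : W ord0 = fun=> 1. Proof. by apply/funext => x; exact: leafvec0. Qed.
Lemma leafvec_upE a : W (up a) = E a. Proof. by apply/funext => x; exact: leafvec_up. Qed.

Lemma smooth_leafvec j : smoothC D (W j).
Proof.
case: (unliftP ord0 j) => [a ->|->]; first by rewrite leafvec_upE.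
by rewrite leafvec0E; exact: smoothC_cst.
Qed.
Let sW := smooth_leafvec.
Let sWc j := smoothC_conj oD (sW j).

Lemma der_leafvec0 L x : derivation D L -> D x -> L (W ord0) x = 0.
Proof. by move=> dL Dx; rewrite leafvec0E (der1 oD dL Dx). Qed.

Lemma der_leafvec0_conj L x : derivation D L -> D x -> L (fun y => (W ord0 y)^*%C) x = 0.
Proof.
move=> dL Dx; rewrite -[RHS](der1 oD dL Dx); apply: (der_eq_on dL Dx) => y _.
by rewrite leafvec0 conjc1.
Qed.

(* [X] and [Xb] are the fields d_z and its conjugate along the leaves. *)
Definition X (F : V -> C) (x : V) : C := \sum_j W j x * d j F x.
Definition Xb (F : V -> C) (x : V) : C := \sum_j (W j x)^*%C * db j F x.

Lemma derivation_X : derivation D X.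
Proof. exact: derivation_sum. Qed.

Lemma derivation_Xb : derivation D Xb.
Proof. exact: derivation_sum. Qed.

Lemma X_conj F x : D x -> smoothC D F -> X (fun y => (F y)^*%C) x = (Xb F x)^*%C.
Proof.
move=> Dx sF; rewrite /X /Xb rmorph_sum; apply: eq_bigr => j _.
by rewrite rmorphM /= conjcK d_conj.
Qed.

Lemma Xb_conj F x : D x -> smoothC D F -> Xb (fun y => (F y)^*%C) x = (X F x)^*%C.
Proof.
move=> Dx sF; rewrite /X /Xb rmorph_sum; apply: eq_bigr => j _.
by rewrite rmorphM /= db_conj.
Qed.

Lemma H_ker_conj j x : D x -> \sum_k (W k x)^*%C * H j k x = 0.
Proof.
move=> Dx; have := congr1 conjc (H_ker j Dx); rewrite conjc0 rmorph_sum => K; rewrite -[RHS]K.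
apply: eq_bigr => k _.
by rewrite rmorphM /= -H_herm.
Qed.

Lemma H_closed_bar i j k x : D x -> db i (H j k) x = db k (H j i) x.
Proof.
move=> Dx.
have e b y : D y -> H j b y = (H b j y)^*%C by exact: H_herm.
rewrite (der_eq_on (der_db i) Dx (e k)) (der_eq_on (der_db k) Dx (e i)).
by rewrite !db_conj // H_closed.
Qed.

(** Leibniz on the kernel relation. With [L] equal to [Xb], [db] and [d] it yields in turn the
    holomorphy of [E] along leaves, the symmetry of [A^T g] and the derivative of [g] along [X]. *)
Lemma der_H_ker L k x : derivation D L -> D x ->
  \sum_j L (W j) x * H j k x = - \sum_j W j x * L (H j k) x.
Proof.
move=> dL Dx; apply/eqP; rewrite -addr_eq0 -big_split /=; apply/eqP.
rewrite -[RHS](der0 oD dL Dx).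
transitivity (L (fun y => \sum_j W j y * H j k y) x); last first.
  by apply: (der_eq_on dL Dx) => y; exact: H_ker.
have S := @der_sum _ _ _ oD _ (index_enum 'I_n.+1) xpredT
  (fun j y => W j y * H j k y) L x dL Dx (fun j => smoothC_mul oD (sW j) (sH j k)).
by rewrite S; apply: eq_bigr => j _; rewrite (der_mul dL Dx).
Qed.

(** The vector [Xb W] is itself in the kernel of [H]: closedness trades the index contracted in [Xb]
    for the free one [l], Leibniz moves [db l] from [H] onto [W], and the remaining factor is [H]
    contracted with the conjugate of [W], which is 0. Since the z-component of [Xb W] vanishes,
    invertibility of the block [gmx] kills the rest. *)
Lemma Xb_leafvec j x : D x -> Xb (W j) x = 0.
Proof.
move=> Dx.
have Z l : \sum_i Xb (W i) x * H i l x = 0.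
  rewrite (der_H_ker l derivation_Xb Dx); apply/eqP; rewrite oppr_eq0; apply/eqP.
  transitivity (\sum_k (W k x)^*%C * \sum_i W i x * db l (H i k) x).
    under eq_bigr do rewrite /Xb mulr_sumr.
    rewrite exchange_big; apply: eq_bigr => k _; rewrite mulr_sumr.
    by apply: eq_bigr => i _; rewrite mulrCA H_closed_bar.
  transitivity (- \sum_i db l (W i) x * \sum_k (W k x)^*%C * H i k x).
    under eq_bigr => k _ do
      rewrite -[\sum_i _]opprK -(der_H_ker k (der_db l) Dx) mulrN mulr_sumr.
    rewrite sumrN exchange_big; congr (- _); apply: eq_bigr => i _; rewrite mulr_sumr.
    by apply: eq_bigr => k _; rewrite mulrCA.
  by rewrite big1 ?oppr0 // => i _; rewrite H_ker_conj // mulr0.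
have X0 : Xb (W ord0) x = 0 by exact: der_leafvec0 derivation_Xb Dx.
have [uG _] := posdefmx_inv (gpos Dx).
pose z : 'rV[C]_n := \row_a Xb (W (up a)) x.
have zG : z *m gmx x = 0.
  apply/rowP => b; rewrite !mxE -[RHS](Z (up b)) big_ord_recl X0 mul0r add0r.
  by apply: eq_bigr => a _; rewrite !mxE.
have z0 : z = 0 by rewrite -[z](mulmxK uG) zG mul0mx.
case: (unliftP ord0 j) => [a ->|-> //].
by move/rowP: z0 => /(_ a); rewrite !mxE.
Qed.

Lemma X_leafvec_conj j x : D x -> X (fun y => (W j y)^*%C) x = 0.
Proof. by move=> Dx; rewrite X_conj // Xb_leafvec // conjc0. Qed.

(** The commutator of [L] with [X] only sees the derivatives of the coefficients of [X], once [L]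
    commutes with each [d j] on [F]. *)
Lemma der_X L F x : derivation D L -> D x -> smoothC D F ->
  (forall j, L (d j F) x = d j (L F) x) ->
  L (X F) x = X (L F) x + \sum_j L (W j) x * d j F x.
Proof.
move=> dL Dx sF cL.
have S := @der_sum _ _ _ oD _ (index_enum 'I_n.+1) xpredT
  (fun j y => W j y * d j F y) L x dL Dx
  (fun j => smoothC_mul oD (sW j) (der_smooth (der_d j) sF)).
rewrite /X S -big_split; apply: eq_bigr => j _ /=.
by rewrite (der_mul dL Dx) ?cL 1?addrC //; exact: der_smooth.
Qed.

Lemma der_Xb L F x : derivation D L -> D x -> smoothC D F ->
  (forall j, L (db j F) x = db j (L F) x) ->
  L (Xb F) x = Xb (L F) x + \sum_j L (fun y => (W j y)^*%C) x * db j F x.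
Proof.
move=> dL Dx sF cL.
have S := @der_sum _ _ _ oD _ (index_enum 'I_n.+1) xpredT
  (fun j y => (W j y)^*%C * db j F y) L x dL Dx
  (fun j => smoothC_mul oD (sWc j) (der_smooth (der_db j) sF)).
rewrite /Xb S -big_split; apply: eq_bigr => j _ /=.
by rewrite (der_mul dL Dx) ?cL 1?addrC //; exact: der_smooth.
Qed.

(* [X, Xb] = 0 because [eta] is holomorphic along the leaves. *)
Lemma X_Xb F x : D x -> smoothC D F -> X (Xb F) x = Xb (X F) x.
Proof.
move=> Dx sF.
have S := @der_sum _ _ _ oD _ (index_enum 'I_n.+1) xpredT
  (fun j y => (W j y)^*%C * db j F y) X x derivation_X Dx
  (fun j => smoothC_mul oD (sWc j) (der_smooth (der_db j) sF)).
transitivity (\sum_k (W k x)^*%C * X (db k F) x).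
  rewrite {1}/Xb S; apply: eq_bigr => k _.
  rewrite (der_mul derivation_X Dx) //; last exact: der_smooth.
  by rewrite X_leafvec_conj // mul0r add0r.
transitivity (\sum_k (W k x)^*%C * (db k (X F) x - \sum_j db k (W j) x * d j F x)).
  apply: eq_bigr => k _; congr (_ * _); rewrite der_X ?addrK //.
  by move=> j; rewrite d_db.
under eq_bigr do rewrite mulrBr mulr_sumr.
rewrite sumrB [X in _ - X](_ : _ = 0) ?subr0 //.
rewrite exchange_big big1 // => j _ /=.
under eq_bigr do rewrite mulrA.
by rewrite -mulr_suml -[\sum_k _]/(Xb (W j) x) Xb_leafvec // mul0r.
Qed.

(** The w-part of dbar [E]. Since [Xb] annihilates [E], the zbar-part is determined by it, so this
    matrix is the whole obstruction to holomorphy of the leaf field. *)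
Definition Amx (x : V) : 'M[C]_n := \matrix_(a, b) db (up b) (E a) x.
Definition Pmx (x : V) : 'M[C]_n := \matrix_(a, b) d (up b) (E a) x.

Lemma smooth_Amx : smoothmx D Amx.
Proof.
move=> a b; apply: (smoothC_eq_on oD _ (der_smooth (der_db (up b)) (sE a))) => x _.
by rewrite mxE.
Qed.

Lemma smooth_Pmx : smoothmx D Pmx.
Proof.
move=> a b; apply: (smoothC_eq_on oD _ (der_smooth (der_d (up b)) (sE a))) => x _.
by rewrite mxE.
Qed.

Lemma smooth_gmx : smoothmx D gmx.
Proof.
by move=> a b; apply: (smoothC_eq_on oD _ (sH (up a) (up b))) => x _; rewrite mxE.
Qed.

Lemma dmxX_conj m p (M : V -> 'M[C]_(m, p)) x : D x -> smoothmx D M ->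
  dmx X (fun y => cj (M y)) x = cj (dmx Xb M x).
Proof.
move=> Dx sM; apply/matrixP => a b; rewrite !mxE -X_conj //.
by apply: (der_eq_on derivation_X Dx) => y _; rewrite mxE.
Qed.

Lemma dmxXb_conj m p (M : V -> 'M[C]_(m, p)) x : D x -> smoothmx D M ->
  dmx Xb (fun y => cj (M y)) x = cj (dmx X M x).
Proof.
move=> Dx sM; apply/matrixP => a b; rewrite !mxE -Xb_conj //.
by apply: (der_eq_on derivation_Xb Dx) => y _; rewrite mxE.
Qed.

Lemma dmx_XXb m p (M : V -> 'M[C]_(m, p)) x : D x -> smoothmx D M ->
  dmx X (dmx Xb M) x = dmx Xb (dmx X M) x.
Proof.
move=> Dx sM; apply/matrixP => a b; rewrite !mxE.
transitivity (X (Xb (fun y => M y a b)) x).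
  by apply: (der_eq_on derivation_X Dx) => y _; rewrite mxE.
by rewrite X_Xb //; apply: (der_eq_on derivation_Xb Dx) => y _; rewrite mxE.
Qed.

(** Apply [db (up b)] to [Xb E = 0]. Only the commutator with [Xb] survives, and its coefficients,
    the derivatives of the conjugate of [E], are conjugates of entries of [Pmx]. *)
Lemma Xb_Amx x : D x -> dmx Xb Amx x = - (Amx x *m cj (Pmx x)).
Proof.
move=> Dx; apply/matrixP => a b; rewrite !mxE.
transitivity (Xb (db (up b) (E a)) x).
  by apply: (der_eq_on derivation_Xb Dx) => y _; rewrite mxE.
have K := der_Xb (der_db (up b)) Dx (sE a) (fun j => db_db _ _ Dx (sE a)).
have Z : db (up b) (Xb (E a)) x = 0.
  rewrite -[RHS](der0 oD (der_db (up b)) Dx); apply: (der_eq_on (der_db _) Dx) => y Dy.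
  by rewrite -leafvec_upE Xb_leafvec.
move: K; rewrite Z => /esym/eqP; rewrite addr_eq0 => /eqP ->; congr (- _).
rewrite big_ord_recl der_leafvec0_conj // mul0r add0r; apply: eq_bigr => c _.
by rewrite leafvec_upE db_conj // !mxE mulrC.
Qed.

(** The same commutator argument, starting from [X] applied to the conjugate of [E]; here the
    coefficients of [X] contribute [Amx]. *)
Lemma X_conjPmx x : D x -> dmx X (fun y => cj (Pmx y)) x = - (cj (Amx x) *m Amx x).
Proof.
move=> Dx; apply/matrixP => c b; rewrite !mxE.
have sEc := smoothC_conj oD (sE c).
transitivity (X (db (up b) (fun y => (E c y)^*%C)) x).
  by apply: (der_eq_on derivation_X Dx) => y Dy; rewrite !mxE db_conj.
have K := der_X (der_db (up b)) Dx sEc (fun j => esym (d_db _ _ Dx sEc)).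
have Z : db (up b) (X (fun y => (E c y)^*%C)) x = 0.
  rewrite -[RHS](der0 oD (der_db (up b)) Dx); apply: (der_eq_on (der_db _) Dx) => y Dy.
  by rewrite -leafvec_upE X_leafvec_conj.
move: K; rewrite Z => /esym/eqP; rewrite addr_eq0 => /eqP ->; congr (- _).
rewrite big_ord_recl der_leafvec0 // mul0r add0r; apply: eq_bigr => a _.
by rewrite leafvec_upE d_conj // !mxE mulrC.
Qed.

(** The kernel relation moves the derivative from [E] onto [H], where closedness in the barred
    indices exchanges [b] and [c]. *)
Lemma Amx_sym x : D x -> ((Amx x)^T *m gmx x)^T = (Amx x)^T *m gmx x.
Proof.
move=> Dx.
have e b c : ((Amx x)^T *m gmx x) b c = - \sum_j W j x * db (up b) (H j (up c)) x.
  rewrite -(der_H_ker (up c) (der_db (up b)) Dx) big_ord_recl der_leafvec0 // mul0r add0r.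
  by rewrite mxE; apply: eq_bigr => a _; rewrite !mxE leafvec_upE.
apply/matrixP => b c; rewrite mxE !e; congr (- _); apply: eq_bigr => j _.
by rewrite H_closed_bar.
Qed.

(** Closedness exchanges the index contracted with [W] and the index [a], after which the kernel
    relation moves [d (up a)] from [H] onto [E]. *)
Lemma X_gmx x : D x -> dmx X gmx x = - ((Pmx x)^T *m gmx x).
Proof.
move=> Dx; apply/matrixP => a c; rewrite !mxE.
transitivity (X (H (up a) (up c)) x).
  by apply: (der_eq_on derivation_X Dx) => y _; rewrite mxE.
transitivity (\sum_j W j x * d (up a) (H j (up c)) x).
  by apply: eq_bigr => j _; rewrite H_closed.
rewrite -[LHS]opprK -(der_H_ker (up c) (der_d (up a)) Dx); congr (- _).
rewrite big_ord_recl der_leafvec0 // mul0r add0r.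
by apply: eq_bigr => b _; rewrite !mxE leafvec_upE.
Qed.

(* [Q^T g] is the [X]-derivative of the symmetric matrix [A^T g]. *)
Local Notation Q x := (dmx X Amx x - Pmx x *m Amx x).

Lemma Q_sym x : D x -> ((Q x)^T *m gmx x)^T = (Q x)^T *m gmx x.
Proof.
move=> Dx.
have sAt := smoothmx_tr oD smooth_Amx.
have e : dmx X (fun y => (Amx y)^T *m gmx y) x = (Q x)^T *m gmx x.
  rewrite (dmx_mul oD derivation_X Dx sAt smooth_gmx) (dmx_tr derivation_X) // X_gmx //.
  by rewrite mulmxN mulmxA linearB /= trmx_mul mulmxBl.
rewrite -e -(dmx_tr derivation_X) //; apply: (dmx_eq_on derivation_X Dx) => y Dy.
exact: Amx_sym.
Qed.

Definition Str (x : V) : C := \tr (cj (Amx x) *m Amx x).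

Lemma X_Xb_Str x : D x -> X (Xb Str) x =
  2%:R * \tr (cj (Amx x) *m Amx x *m (cj (Amx x) *m Amx x)) +
  \tr (cj (Q x) *m Q x).
Proof.
move=> Dx.
have sA := smooth_Amx; have sAc := smoothmx_conj oD sA.
have sP := smooth_Pmx; have sPc := smoothmx_conj oD sP.
have sAP := smoothmx_mul oD sA sPc.
have dX := derivation_X; have dXb := derivation_Xb.
have s1 := smoothmx_mul oD (smoothmx_dmx oD dXb sAc) sA.
have s2 := smoothmx_mul oD sAc (smoothmx_opp oD sAP).
have XbS y : D y -> Xb Str y =
    \tr (dmx Xb (fun z => cj (Amx z)) y *m Amx y + cj (Amx y) *m - (Amx y *m cj (Pmx y))).
  move=> Dy; rewrite (der_mxtrace oD dXb Dy); last exact: smoothmx_mul.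
  by rewrite (dmx_mul oD dXb Dy sAc sA) (Xb_Amx Dy).
have XAc y : D y -> dmx X (fun z => cj (Amx z)) y = - (cj (Amx y) *m Pmx y).
  move=> Dy; rewrite dmxX_conj // Xb_Amx // map_mxN map_mxM /=; congr (- (_ *m _)).
  by apply/matrixP => a b; rewrite !mxE conjcK.
have XbP : dmx Xb Pmx x = - (Amx x *m cj (Amx x)).
  have -> : dmx Xb Pmx x = cj (dmx X (fun y => cj (Pmx y)) x).
    rewrite dmxX_conj //; apply/matrixP => a b; rewrite !mxE conjcK //.
  rewrite X_conjPmx // map_mxN map_mxM /=; congr (- (_ *m _)).
  by apply/matrixP => a b; rewrite !mxE conjcK.
rewrite (der_eq_on dX Dx XbS) (der_mxtrace oD dX Dx); last first.
  by move=> a b; apply: (smoothC_eq_on oD _ (smoothC_add oD (s1 a b) (s2 a b))) => y _; rewrite [RHS]mxE.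
rewrite (dmx_add dX Dx s1 s2) (dmx_mul oD dX Dx (smoothmx_dmx oD dXb sAc) sA).
rewrite (dmx_mul oD dX Dx sAc (smoothmx_opp oD sAP)) (dmx_opp oD dX Dx sAP).
(* [X Xb] of the conjugate of [A] is the only term with two field derivatives of [A]. After
   exchanging the fields it is [Xb] of [- cj A *m P], to which [XbP] applies. *)
rewrite (dmx_mul oD dX Dx sA sPc) X_conjPmx // XAc // dmx_XXb //.
rewrite (dmx_eq_on dXb Dx XAc) (dmx_opp oD dXb Dx (smoothmx_mul oD sAc sP)).
rewrite (dmx_mul oD dXb Dx sAc sP) XbP dmxXb_conj // map_mxB map_mxM /=.
move: (dmx X Amx x) (Amx x) (Pmx x) => T A P.
move: (cj T) (cj A) (cj P) => U B Pc.
have trN (M : 'M[C]_n) : \tr (- M) = - \tr M by exact: raddfN.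
rewrite !(mulmxBl, mulmxBr, mulmxDl, mulmxDr, mulmxN, mulNmx, opprD, opprK) !mulmxA.
rewrite !(mxtraceD, trN).
(* Both sides are now traces of words in [T], [A], [P] and their conjugates; they agree up to cyclic
   rotation of the two words beginning with [Pc] that come from the square of [Q]. *)
have c1 : \tr (Pc *m B *m T) = \tr (B *m T *m Pc) by rewrite -mulmxA mxtrace_mulC.
have c2 : \tr (Pc *m B *m P *m A) = \tr (B *m P *m A *m Pc).
  by rewrite -!mulmxA mxtrace_mulC !mulmxA.
rewrite c1 c2.
ring.
Qed.

Lemma Str_ineq x : (0 < n)%N -> D x ->
  2%:R / n%:R * Str x ^+ 2 <= X (Xb Str) x.
Proof.
move=> n0 Dx; rewrite X_Xb_Str //.
exact: (posdefmx_trace_ineq n0 (gpos Dx) (Amx_sym Dx) (Q_sym Dx)).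
Qed.

End MongeAmpereFoliation.

(** * Constant-coefficient complex directional operators *)

Section Wirtinger.
Variables (R : realType) (V : normedModType R) (D : set V).
Hypothesis oD : open D.
Local Notation C := (R[i]).
Implicit Types (a b : C) (u v : V) (F : V -> C).

(** One family containing both kinds of Wirtinger derivative, so that the Leibniz, commutation and
    conjugation rules are each proved once. *)
Definition wirt a b u v F (x : V) : C := a * pdC u F x + b * pdC v F x.

Lemma pdC_cst v c x : pdC v (fun=> c) x = 0 :> C.
Proof. by rewrite pdCE !derive_cst. Qed.

Lemma derivation_wirt a b u v : derivation D (wirt a b u v).
Proof.
split=> [F sF|F G x Dx FG|F G x Dx sF sG|F G x Dx sF sG]; rewrite /wirt.
- by apply: smoothC_add => //; apply: smoothC_mul => //;
    (exact: smoothC_cst || exact: smoothC_pdC).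
- by rewrite !(pdC_eq_on oD _ Dx FG).
- have e (p q r s : C) : a * (p + q) + b * (r + s) = a * p + b * r + (a * q + b * s) by ring.
  by rewrite (pdC_add u Dx sF sG) (pdC_add v Dx sF sG); exact: e.
have e (p q r s f g : C) : a * (p * g + f * q) + b * (r * g + f * s) =
    (a * p + b * r) * g + f * (a * q + b * s) by ring.
by rewrite (pdC_mul u Dx sF sG) (pdC_mul v Dx sF sG); exact: e.
Qed.

Lemma pdC_wirt a b u v w F x : D x -> smoothC D F ->
  pdC w (wirt a b u v F) x = a * pdC w (pdC u F) x + b * pdC w (pdC v F) x.
Proof.
move=> Dx sF.
have sc c : smoothC D (fun=> c) := smoothC_cst oD c.
have sd z : smoothC D (pdC z F) := smoothC_pdC oD z sF.
have m c z : pdC w (fun y => c * pdC z F y) x = c * pdC w (pdC z F) x.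
  apply: etrans (pdC_mul w Dx (sc c) (sd z)) _.
  by rewrite (pdC_cst w c) mul0r add0r.
apply: etrans (pdC_add w Dx (smoothC_mul oD (sc a) (sd u)) (smoothC_mul oD (sc b) (sd v))) _.
by congr (_ + _); exact: m.
Qed.

Lemma wirt_comm a b a' b' u v u' v' F x : D x -> smoothC D F ->
  wirt a b u v (wirt a' b' u' v' F) x = wirt a' b' u' v' (wirt a b u v F) x.
Proof.
move=> Dx sF.
have e c d z t c' d' z' t' : wirt c d z t (wirt c' d' z' t' F) x =
    c * (c' * pdC z (pdC z' F) x + d' * pdC z (pdC t' F) x) +
    d * (c' * pdC t (pdC z' F) x + d' * pdC t (pdC t' F) x).
  by rewrite {1}/wirt; congr (_ * _ + _ * _); exact: pdC_wirt.
rewrite !e.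
have c1 := pdC_comm oD u' u Dx sF; have c2 := pdC_comm oD v' u Dx sF.
have c3 := pdC_comm oD u' v Dx sF; have c4 := pdC_comm oD v' v Dx sF.
have swap (p q r t p' q' r' t' : C) : p = p' -> q = q' -> r = r' -> t = t' ->
    a * (a' * p + b' * q) + b * (a' * r + b' * t) =
    a' * (a * p' + b * r') + b' * (a * q' + b * t').
  by move=> -> -> -> ->; ring.
exact: swap c1 c2 c3 c4.
Qed.

Lemma wirt_conj a b u v F x : D x -> smoothC D F ->
  wirt a b u v (fun y => (F y)^*%C) x = (wirt (a^*%C) (b^*%C) u v F x)^*%C.
Proof.
move=> Dx sF; rewrite /wirt (pdC_conj u Dx sF) (pdC_conj v Dx sF).
have conjE (p q : C) : a * p^*%C + b * q^*%C = (a^*%C * p + b^*%C * q)^*%C.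
  by rewrite rmorphD !rmorphM /= !conjcK.
exact: conjE.
Qed.

End Wirtinger.

Lemma continuous_pairmap (S T S' T' : topologicalType) (f : S -> S') (g : T -> T') :
  continuous f -> continuous g -> continuous (fun p : S * T => (f p.1, g p.2)).
Proof.
move=> cf cg p.
apply: (@cvg_pair (S * T)%type S' T' (nbhs p) (nbhs (f p.1)) (nbhs (g p.2)) _ _ _
  (f \o fst) (g \o snd)).
  by apply: continuous_comp; [exact: cvg_fst|exact: cf].
by apply: continuous_comp; [exact: cvg_snd|exact: cg].
Qed.

(** * Wirtinger derivatives in coordinates and the projection to M *)

Section Coordinates.
Variables (R : realType) (n : nat).
Local Notation C := (R[i]).
Local Notation up := (lift ord0).
Let half : C := 2%:R^-1.
Let ihalf : C := 'i%C / 2%:R.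

Lemma dWE j : @dW R n j = wirt half (- ihalf) (unitrow R j, 0) (0, unitrow R j).
Proof.
have e (p q : C) : (p - 'i%C * q) / 2%:R = half * p + - ihalf * q.
  by rewrite /half /ihalf; ring.
by apply/funext => F; apply/funext => p; exact: e.
Qed.

Lemma dWbE j : @dWb R n j = wirt half ihalf (unitrow R j, 0) (0, unitrow R j).
Proof.
have e (p q : C) : (p + 'i%C * q) / 2%:R = half * p + ihalf * q.
  by rewrite /half /ihalf; ring.
by apply/funext => F; apply/funext => p; exact: e.
Qed.

Lemma half_conj : half^*%C = half.
Proof. by rewrite /half conjc_inv conjc_nat. Qed.

Lemma ihalf_conj : (- ihalf)^*%C = ihalf.
Proof.
have e (p q : C) : (- (p * q))^*%C = - p^*%C * q^*%C by rewrite rmorphN rmorphM mulNr.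
rewrite /ihalf e half_conj; congr (_ * _).
by apply/eqP; rewrite eq_complex /= oppr0 opprK !eqxx.
Qed.

Section OnOpen.
Variable D : set (Pt R n).
Hypothesis oD : open D.

Lemma derivation_dW j : derivation D (dW j).
Proof. by rewrite dWE; exact: derivation_wirt. Qed.

Lemma derivation_dWb j : derivation D (dWb j).
Proof. by rewrite dWbE; exact: derivation_wirt. Qed.

Lemma dW_dWb j k F x : D x -> smoothC D F -> dW j (dWb k F) x = dWb k (dW j F) x.
Proof. by move=> Dx sF; rewrite dWE dWbE (wirt_comm oD). Qed.

Lemma dW_dW j k F x : D x -> smoothC D F -> dW j (dW k F) x = dW k (dW j F) x.
Proof. by move=> Dx sF; rewrite !dWE (wirt_comm oD). Qed.

Lemma dW_conj j F x : D x -> smoothC D F -> dW j (fun y => (F y)^*%C) x = (dWb j F x)^*%C.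
Proof. by move=> Dx sF; rewrite dWE dWbE (wirt_conj _ _ _ _ Dx sF) half_conj ihalf_conj. Qed.

End OnOpen.

(** The map [wpart] rewritten by block extraction, from which linearity and continuity are
    immediate; [smooth_pullback] requires both. *)
Definition wproj (p : Pt R n) : Mpt R n :=
  (rsubmx (p.1 : 'rV[R]_(1 + n)), rsubmx (p.2 : 'rV[R]_(1 + n))).

Lemma wprojE p : wpart p = wproj p.
Proof.
by congr pair; apply/rowP => a; rewrite !mxE; congr (_ _ _); exact/val_inj.
Qed.

Lemma wproj_is_linear : linear wproj.
Proof. by move=> a p q; rewrite /wproj /= !linearP. Qed.

HB.instance Definition _ := GRing.isLinear.Build R (Pt R n) (Mpt R n) _ wproj wproj_is_linear.

Lemma continuous_wproj : continuous wproj.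
Proof.
pose r : 'M[R]_(1, 1 + n) -> 'M[R]_(1, n) := rsubmx.
have cr : continuous r by exact: continuous_rsubmx.
exact: (continuous_pairmap cr cr).
Qed.

Lemma continuous_zpart : continuous (@zpart R n).
Proof.
pose c : 'M[R]_(1, n.+1) -> R := fun x => x 0 ord0.
have cc : continuous c by exact: coord_continuous.
exact: (continuous_pairmap cc cc).
Qed.

Lemma wproj_up a : wproj (unitrow R (up a), 0) = (unitrow R a, 0) /\
  wproj (0, unitrow R (up a)) = (0, unitrow R a).
Proof.
have r0 : rsubmx (0 : 'rV[R]_(1 + n)) = 0 by exact: linear0.
have ru : rsubmx (unitrow R (up a) : 'rV[R]_(1 + n)) = unitrow R a.
  apply/rowP => k; rewrite !mxE.
  have -> : rshift 1 k = up k by exact/val_inj.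
  by rewrite (inj_eq (@lift_inj _ _)).
by rewrite /wproj /= r0 ru.
Qed.

Lemma wproj_0 : wproj (unitrow R ord0, 0) = 0 /\ wproj (0, unitrow R ord0) = 0.
Proof.
have r0 : rsubmx (0 : 'rV[R]_(1 + n)) = 0 by exact: linear0.
have ru : rsubmx (unitrow R ord0 : 'rV[R]_(1 + n)) = 0.
  by apply/rowP => k; rewrite !mxE.
by rewrite /wproj /= r0 ru.
Qed.

Lemma pdC_wproj v (F : Mpt R n -> C) p :
  pdC v (fun q => F (wproj q)) p = pdC (wproj v) F (wproj p).
Proof.
pose L : {linear Pt R n -> Mpt R n} := wproj.
rewrite !pdCE; congr Complex.
  exact: (derive_pullback L (fun m => complex.Re (F m))).
exact: (derive_pullback L (fun m => complex.Im (F m))).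
Qed.

Lemma pdC_dir0 (F : Mpt R n -> C) m : pdC 0 F m = 0.
Proof. by rewrite pdCE !derive0. Qed.

Lemma dW_wproj_up a (F : Mpt R n -> C) p :
  dW (up a) (fun q => F (wproj q)) p = dWM a F (wproj p).
Proof. by rewrite /dW /dWM !pdC_wproj (wproj_up a).1 (wproj_up a).2. Qed.

Lemma dW_wproj_0 (F : Mpt R n -> C) p : dW ord0 (fun q => F (wproj q)) p = 0.
Proof. by rewrite /dW !pdC_wproj wproj_0.1 wproj_0.2 !pdC_dir0 mulr0 subr0 mul0r. Qed.

Lemma dW_cst (j : 'I_n.+1) (c : C) (p : Pt R n) : dW j (fun=> c) p = 0.
Proof. by rewrite /dW !pdC_cst mulr0 subr0 mul0r. Qed.

Lemma posdefmx_herm (G : 'M[C]_n) : herm_posdef G -> posdefmx G.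
Proof.
move=> [Gh Gp]; split.
  by apply/matrixP => a b; rewrite !mxE [RHS]Gh.
move=> v v0; have := Gp v v0; congr (0 < _).
rewrite mxE exchange_big /=; apply: eq_bigr => b _.
by rewrite !mxE mulr_suml.
Qed.

End Coordinates.

(** * The Monge-Ampere setup in a chart as an instance of the abstract foliation *)

Section LocalSetup.
Variables (R : realType) (n : nat) (Sigma : set (R * R)) (U : set (Mpt R n)).
Variables (g0 : 'I_n -> 'I_n -> Mpt R n -> R[i]) (phi : Pt R n -> R).
Local Notation C := (R[i]).
Local Notation up := (lift ord0).
Let D := [set p : Pt R n | Sigma (zpart p) /\ U (wpart p)].
Hypotheses (oS : open Sigma) (oU : open U).
Hypothesis sg0 : forall a b, smooth_on U (fun m => complex.Re (g0 a b m)) /\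
                             smooth_on U (fun m => complex.Im (g0 a b m)).
Hypothesis g0p : forall m, U m -> herm_posdef (\matrix_(a, b) g0 a b m).
Hypothesis g0K : forall m, U m -> forall a b c, dWM c (g0 a b) m = dWM a (g0 c b) m.
Hypothesis sphi : smooth_on D phi.
Hypothesis gp : forall p, D p -> herm_posdef (gmat g0 phi p).
Hypothesis H0 : forall p, D p -> \det (Hmat g0 phi p) = 0.

Lemma open_dom : open D.
Proof.
have -> : D = (@zpart R n) @^-1` Sigma `&` (@wproj R n) @^-1` U.
  by apply/seteqP; split => p; rewrite /D /= wprojE.
apply: openI; apply: open_comp => // p _; first exact: continuous_zpart.
exact: continuous_wproj.
Qed.
Let oD := open_dom.

Let phiC (q : Pt R n) : C := (phi q)%:C%C.

Lemma smooth_phiC : smoothC D phiC.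
Proof. by split; [exact: sphi|exact: smooth_cst]. Qed.

Let Hfun (j k : 'I_n.+1) (p : Pt R n) : C := g0ext g0 j k p + dW j (dWb k phiC) p.

Lemma g0ext_up a b : g0ext g0 (up a) (up b) = fun p => g0 a b (wproj p).
Proof. by apply/funext => p; rewrite /g0ext !liftK wprojE. Qed.

Lemma g0ext_0l k : g0ext g0 ord0 k = fun=> 0.
Proof. by apply/funext => p; rewrite /g0ext unlift_none. Qed.

Lemma g0ext_0r j : g0ext g0 j ord0 = fun=> 0.
Proof. by apply/funext => p; rewrite /g0ext unlift_none; case: unlift. Qed.

Lemma smooth_g0ext j k : smoothC D (g0ext g0 j k).
Proof.
case: (unliftP ord0 j) => [a ->|->]; last by rewrite g0ext_0l; exact: smoothC_cst.
case: (unliftP ord0 k) => [b ->|->]; last by rewrite g0ext_0r; exact: smoothC_cst.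
rewrite g0ext_up; have DU p : D p -> U (wproj p) by rewrite -wprojE => -[].
by split; [exact: (smooth_pullback (@continuous_wproj R n) DU (sg0 a b).1)
          |exact: (smooth_pullback (@continuous_wproj R n) DU (sg0 a b).2)].
Qed.

Lemma smooth_phi2 j k : smoothC D (dW j (dWb k phiC)).
Proof.
exact: (der_smooth (derivation_dW oD j) (der_smooth (derivation_dWb oD k) smooth_phiC)).
Qed.

Lemma smooth_Hfun j k : smoothC D (Hfun j k).
Proof. exact: smoothC_add (smooth_g0ext j k) (smooth_phi2 j k). Qed.

Lemma g0ext_herm j k p : D p -> g0ext g0 k j p = (g0ext g0 j k p)^*%C.
Proof.
move=> Dp; case: (unliftP ord0 j) => [a ->|->]; last by rewrite g0ext_0l g0ext_0r conjc0.
case: (unliftP ord0 k) => [b ->|->]; last by rewrite g0ext_0l g0ext_0r conjc0.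
have Uw : U (wproj p) by rewrite -wprojE; exact: Dp.2.
by rewrite !g0ext_up; have := (g0p Uw).1 a b; rewrite !mxE.
Qed.

(** For the Hessian part: [phi] is real, so conjugation swaps barred and unbarred derivatives, and
    their commutation restores the order. *)
Lemma Hfun_herm j k p : D p -> Hfun k j p = (Hfun j k p)^*%C.
Proof.
move=> Dp; have sp := smooth_phiC.
have phi_real y : (phiC y)^*%C = phiC y by rewrite conjc_real.
have conjD (x y : C) : (x + y)^*%C = x^*%C + y^*%C by exact: rmorphD.
have s1 := der_smooth (derivation_dWb oD k) sp.
rewrite /Hfun conjD -g0ext_herm //; congr (_ + _).
rewrite -(db_conj oD (derivation_dW oD) (@dW_conj R n D) j Dp s1).
rewrite (dW_dWb oD _ _ Dp sp); apply: (der_eq_on (derivation_dWb oD j) Dp) => y Dy.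
rewrite -(dW_conj k Dy sp); apply: (der_eq_on (derivation_dW oD k) Dy) => z _.
by rewrite phi_real.
Qed.

(** A form pulled back from M has no z-component and does not vary with z, so mixed index pairs give
    0 on both sides; for two w indices this is the Kaehler condition [g0K]. *)
Lemma g0ext_closed i j k p : D p -> dW i (g0ext g0 j k) p = dW j (g0ext g0 i k) p.
Proof.
move=> Dp; case: (unliftP ord0 k) => [b ->|->]; last by rewrite !g0ext_0r !dW_cst.
case: (unliftP ord0 i) => [a ->|->]; case: (unliftP ord0 j) => [c ->|->].
- rewrite !g0ext_up (dW_wproj_up a) (dW_wproj_up c).
  by apply: g0K; rewrite -wprojE; exact: Dp.2.
- by rewrite g0ext_0l g0ext_up (dW_cst (up a)) dW_wproj_0.
- by rewrite g0ext_0l g0ext_up (dW_cst (up c)) dW_wproj_0.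
exact: erefl.
Qed.

Lemma Hfun_closed i j k p : D p -> dW i (Hfun j k) p = dW j (Hfun i k) p.
Proof.
move=> Dp.
rewrite (der_add (derivation_dW oD i) Dp (smooth_g0ext j k) (smooth_phi2 j k)).
rewrite (der_add (derivation_dW oD j) Dp (smooth_g0ext i k) (smooth_phi2 i k)).
apply: f_equal2; first exact: (g0ext_closed i j k Dp).
exact: (dW_dW oD i j Dp (der_smooth (derivation_dWb oD k) smooth_phiC)).
Qed.

Lemma gmatE p : gmat g0 phi p = gmx Hfun p.
Proof. by apply/matrixP => a b; rewrite !mxE. Qed.

Lemma gmx_posdef p : D p -> posdefmx (gmx Hfun p).
Proof. by move=> Dp; rewrite -gmatE; exact/posdefmx_herm/gp. Qed.

Lemma smooth_eta a : smoothC D (Defs.eta g0 phi a).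
Proof.
apply: smoothC_opp => //; apply: smoothC_sum => // b.
apply: smoothC_mul => //; last exact: smooth_phi2.
apply: smoothC_invmx => // [i j|p Dp].
  by apply: (smoothC_eq_on oD _ (smooth_Hfun (up i) (up j))) => q _; rewrite gmatE mxE.
by rewrite gmatE; have [] := posdefmx_inv (gmx_posdef Dp).
Qed.

Local Notation W := (leafvec (Defs.eta g0 phi)).

(* A null row vector of [Hmat] has nonzero first entry since the block [gmat] is
   invertible, and the same block then determines the others. *)
Lemma leafvec_ker k p : D p -> \sum_j W j p * Hfun j k p = 0.
Proof.
move=> Dp; have /eqP/det0P[u u0 uH] := H0 Dp.
have [uG _] := posdefmx_inv (gmx_posdef Dp).
have uHE l : \sum_j u 0 j * Hfun j l p = 0.
  have /rowP/(_ l) := uH; rewrite !mxE => K; rewrite -[RHS]K.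
  by apply: eq_bigr => j _; rewrite mxE.
pose h : 'rV[C]_n := \row_b Hfun ord0 (up b) p.
pose w : 'rV[C]_n := \row_a u 0 (up a).
have wG : w *m gmx Hfun p = - (u 0 ord0 *: h).
  apply/rowP => b; have := uHE (up b); rewrite big_ord_recl addrC => /eqP.
  rewrite addr_eq0 !mxE => /eqP <-; apply: eq_bigr => a _; by rewrite !mxE.
have wE : w = - (u 0 ord0 *: h) *m invmx (gmx Hfun p) by rewrite -wG mulmxK.
have uE a : u 0 (up a) = u 0 ord0 * Defs.eta g0 phi a p.
  move/rowP: wE => /(_ a); rewrite mxE => ->.
  rewrite mulNmx mxE -scalemxAl mxE /Defs.eta mulrN gmatE; congr (- (_ * _)).
  rewrite mxE; apply: eq_bigr => b _; rewrite mulrC; congr (_ * _).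
  by rewrite mxE /Hfun g0ext_0l add0r.
have u00 : u 0 ord0 != 0.
  apply: contraNneq u0 => u00; apply/eqP/rowP => j; rewrite mxE.
  by case: (unliftP ord0 j) => [a ->|-> //]; rewrite uE u00 mul0r.
apply: (mulfI u00); rewrite mulr0 mulr_sumr -[RHS](uHE k); apply: eq_bigr => j _.
rewrite mulrA; congr (_ * _); case: (unliftP ord0 j) => [a ->|->].
  by rewrite leafvec_up uE.
by rewrite leafvec0 mulr1.
Qed.

Lemma DzE F p : Dz g0 phi F p = X (@dW R n) (Defs.eta g0 phi) F p.
Proof.
rewrite /Dz /X big_ord_recl leafvec0 mul1r; congr (_ + _).
by apply: eq_bigr => a _; rewrite leafvec_up.
Qed.

Lemma DzbE F p : Dzb g0 phi F p = Xb (@dWb R n) (Defs.eta g0 phi) F p.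
Proof.
rewrite /Dzb /Xb big_ord_recl leafvec0 conjc1 mul1r; congr (_ + _).
by apply: eq_bigr => a _; rewrite leafvec_up.
Qed.

Lemma SfunE p : D p -> Sfun g0 phi p = Str (@dWb R n) (Defs.eta g0 phi) p.
Proof.
move=> Dp; rewrite /Sfun /Str /mxtrace exchange_big; apply: eq_bigr => b _.
rewrite mxE; apply: eq_bigr => a _; rewrite !mxE.
by rewrite (dW_conj _ Dp (smooth_eta b)).
Qed.

Lemma Sfun_ineq p : (0 < n)%N -> D p ->
  2%:R / n%:R * Sfun g0 phi p ^+ 2 <= Dz g0 phi (Dzb g0 phi (Sfun g0 phi)) p.
Proof.
move=> n0 Dp.
have dX : derivation D (X (@dW R n) (Defs.eta g0 phi)).
  exact: (derivation_X oD (derivation_dW oD) smooth_eta).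
have dXb : derivation D (Xb (@dWb R n) (Defs.eta g0 phi)).
  exact: (derivation_Xb oD (derivation_dWb oD) smooth_eta).
rewrite SfunE // DzE.
(* [Sfun] and [Str] are known to agree on [D] only; locality of the two derivations carries the
   equality under both fields. *)
have -> : X (@dW R n) (Defs.eta g0 phi) (Dzb g0 phi (Sfun g0 phi)) p =
    X (@dW R n) (Defs.eta g0 phi) (Xb (@dWb R n) (Defs.eta g0 phi) (Str (@dWb R n) (Defs.eta g0 phi))) p.
  apply: (der_eq_on dX Dp) => q Dq; rewrite DzbE; apply: (der_eq_on dXb Dq).
  exact: SfunE.
exact: (Str_ineq oD (derivation_dW oD) (derivation_dWb oD) (dW_dWb oD) (dW_dW oD)
  (@dW_conj R n D) smooth_Hfun smooth_eta Hfun_herm Hfun_closed leafvec_ker gmx_posdef n0 Dp).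
Qed.

End LocalSetup.

Unset Implicit Arguments.

Theorem theorem4p2p10 (R : realType) (n : nat) (n_gt0 : (0 < n)%N)
    (Sigma : set (R * R)) (U : set (Mpt R n))
    (g0 : 'I_n -> 'I_n -> Mpt R n -> R[i]) (phi : Pt R n -> R) :
  (* Sigma is a domain of C, U is (the image of) a coordinate chart of M *)
  open Sigma -> connected Sigma -> open U ->
  (* omega_0 is a smooth Kaehler metric on M *)
  (forall a b, smooth_on U (fun m => complex.Re (g0 a b m)) /\
               smooth_on U (fun m => complex.Im (g0 a b m))) ->
  (forall m, U m -> herm_posdef (\matrix_(a, b) g0 a b m)) ->
  (forall m, U m -> forall a b c,
      dWM c (g0 a b) m = dWM a (g0 c b) m) ->
  (* phi is smooth on Sigma x M *)
  let D := [set p : Pt R n | Sigma (zpart p) /\ U (wpart p)] in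
  smooth_on D phi ->
  (* omega_phi > 0 on M for each z *)
  (forall p, D p -> herm_posdef (gmat g0 phi p)) ->
  (* homogeneous complex Monge-Ampere equation *)
  (forall p, D p -> \det (Hmat g0 phi p) = 0) ->
  (* conclusion, at every point (i.e. along every leaf) *)
  forall p, D p ->
    (2%:R / n%:R) * Sfun g0 phi p ^+ 2
      <= Dz g0 phi (Dzb g0 phi (Sfun g0 phi)) p.
Proof.
move=> oS _ oU sg0 g0p g0K D sphi gp H0 p Dp.
exact: (Sfun_ineq oS oU sg0 g0p g0K sphi gp H0 n_gt0 Dp).
Qed.
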